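(* Let $R$ be a skew-invertible Hecke $R$-matrix of symmetry rank $p$, $\mathcal{L}_q$ the corresponding modified reflection equation algebra, $V$ its fundamental module of $B$ type, and let $\pi_{(k)}$ and $\pi_{[k]}$ denote the representations $\pi_\nu$ of $\mathcal{L}_q$ in the subspaces $S^{(k)}(R)\triangleright V^{\otimes k}$ ($\nu=(k)$) and $A^{(k)}(R)\triangleright V^{\otimes k}$ ($\nu=(1^k)$, $k\le p$), as defined in the context. (i) The matrices of the operators representing the generators are $$\pi^t_{(k)}(l_i^{\,j})=q^{1-k}k_q\,S^{(k)}(R)\Bigl[\pi^t(l_i^{\,j})\otimes I^{\otimes(k-1)}\Bigr]S^{(k)}(R),$$ $$\pi^t_{[k]}(l_i^{\,j})=q^{k-1}k_q\,A^{(k)}(R)\Bigl[\pi^t(l_i^{\,j})\otimes I^{\otimes(k-1)}\Bigr]A^{(k)}(R),\qquad k\le p.$$ (ii) For $m\ge1$ the central element $s_m=Tr_qL^m$ acts in $\pi_{(k)}$ and in $\pi_{[k]}$ ($k\le p$) as multiplication by, respectively, $$\chi_{(k)}(s_m)=q^{-m(p+k-1)-p}\,k_q\,\bigl((p+k-1)_q\bigr)^{m-1},$$ $$\chi_{[k]}(s_m)=q^{-m(p-k+1)-p}\,k_q\,\bigl((p-k+1)_q\bigr)^{m-1}.$$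
   Context: **Matrices.** Fix $n\ge 1$ and a nonzero $q\in\mathbb{C}$ with $q^k\ne 1$ for all integers $k\geq 1$. Put $\lambda=q-q^{-1}$, $k_q=(q^k-q^{-k})/(q-q^{-1})$. Lower indices of a matrix enumerate rows, upper indices columns. Subscripts of a matrix indicate the tensor factors in which it acts; $I$ is the unit matrix, $P$ the permutation (flip) matrix, $Tr_{(i)}$ the trace in the $i$-th factor. $R_i:=R_{i\,i+1}$. Chains: $R^{\pm1}_{(i\to j)}=R_i^{\pm1}R_{i+1}^{\pm1}\cdots R_j^{\pm1}$ if $i<j$, $R_i^{\pm1}R_{i-1}^{\pm1}\cdots R_j^{\pm1}$ if $i>j$, and $R_i^{\pm1}$ if $i=j$. **$R$-matrix.** $R$ is a complex $n^2\times n^2$ matrix with: (Yang–Baxter) $R_{12}R_{23}R_{12}=R_{23}R_{12}R_{23}$; (Hecke) $(R-qI)(R+q^{-1}I)=0$; (skew-invertibility) there is $\Psi$ with $Tr_{(2)}R_{12}\Psi_{23}=P_{13}=Tr_{(2)}\Psi_{12}R_{23}$; (symmetry rank $p\in\mathbb{N}$) $A^{(p+1)}=0$ and $\mathrm{rank}\,A^{(p)}=1$. Here the $q$-symmetrizers and $q$-antisymmetrizers (idempotents on $k$ tensor factors) are $S^{(1)}=A^{(1)}=I$, $$S^{(k)}_{12\dots k}=\tfrac{1}{k_q}S^{(k-1)}_{2\dots k}\bigl(q^{1-k}I+(k-1)_qR_{12}\bigr)S^{(k-1)}_{2\dots k},\quad A^{(k)}_{12\dots k}=\tfrac{1}{k_q}A^{(k-1)}_{2\dots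 k}\bigl(q^{k-1}I-(k-1)_qR_{12}\bigr)A^{(k-1)}_{2\dots k}.$$ Put $B_1=Tr_{(2)}\Psi_{21}$, $C_1=Tr_{(2)}\Psi_{12}$. For these, $BC=q^{-2p}I$ and $Tr B=Tr C=q^{-p}p_q$. **Algebra.** $\mathcal{L}_q$ is the unital associative $\mathbb{C}$-algebra generated by $l_i^{\,j}$, $1\le i,j\le n$, with relations $R_{12}L_1R_{12}L_1-L_1R_{12}L_1R_{12}=R_{12}L_1-L_1R_{12}$, $L=\|l_i^{\,j}\|$, $L_1=L\otimes I$. The quantum trace of an $n\times n$ matrix $X$ over $\mathcal{L}_q$ is $Tr_q(X)=Tr(C\cdot X)$; the elements $s_m=Tr_q(L^m)$ are central. **Modules.** $V$ is an $n$-dimensional space with basis $e_i$ and action $\pi(l_i^{\,j})e_k=e_iB_k^{\,j}$. A numerical matrix $X$ acts on $V^{\otimes k}$ by $X\triangleright e_I=\sum_JX_I^{\,J}e_J$, $e_I=e_{i_1}\otimes\dots\otimes e_{i_k}$; for an operator $\tau(x)$ on $V^{\otimes k}$, $\tau^t(x)$ is the transposed matrix: $\tau(x)e_I=\sum_J(\tau^t(x))_I^{\,J}e_J$. $V^{\otimes k}$ is an $\mathcal{L}_q$-module via $$\rho_k^t(l_i^{\,j})=\pi^t(l_i^{\,j})\otimes I^{\otimes(k-1)}+\sum_{s=1}^{k-1}R^{-1}_{(s\to1)}\bigl[\pi^t(l_i^{\,j})\otimes I^{\otimes(k-1)}\bigr]R^{-1}_{(1\to s)}.$$ The subspaces $S^{(k)}\triangleright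 V^{\otimes k}$ and $A^{(k)}\triangleright V^{\otimes k}$ are $\mathcal{L}_q$-modules with operators (embedded in $\mathrm{End}(V^{\otimes k})$) given by $\pi^t_{(k)}(l_i^{\,j})=S^{(k)}\rho_k^t(l_i^{\,j})S^{(k)}$ and $\pi^t_{[k]}(l_i^{\,j})=A^{(k)}\rho_k^t(l_i^{\,j})A^{(k)}$. *)

(* Defs.v *)
From HB Require Import structures.
From mathcomp Require Import all_boot all_order all_algebra.
From mathcomp Require Import generic_quotient ring_quotient.
From mathcomp Require Import boolp reals complex.
From mathcomp Require Import monalg.

Set Implicit Arguments.
Unset Strict Implicit.
Unset Printing Implicit Defensive.

Import GRing.Theory.

Local Open Scope ring_scope.
Local Open Scope quotient_scope.

(******************************************************************************)
(* Matrices on tensor powers.  A matrix on V^{(x)k}, dim V = n, has size      *)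
(* n^k; its rows and columns are indexed (through enum_rank) by multi-indices *)
(* I = (i_1, ..., i_k), i.e. by functions 'I_k -> 'I_n.  The row index is the *)
(* lower index and the column index is the upper one.                         *)
(* Tensor factors are labelled 1, ..., k, as in R_{12}; the label t is the    *)
(* element t - 1 of 'I_k.                                                     *)
(******************************************************************************)

Definition multi (n k : nat) : finType := {ffun 'I_k -> 'I_n}.

Definition tdim (n k : nat) : nat := #|multi n k|.

Section TensorOps.
Context {A : pzRingType} {n : nat}.

Definition opmx k (f : multi n k -> multi n k -> A) : 'M[A]_(tdim n k) :=
  \matrix_(a, b) f (enum_val a) (enum_val b).

Definition opcoef k (X : 'M[A]_(tdim n k)) (I J : multi n k) : A :=
  X (enum_rank I) (enum_rank J).

Definition op1 (X : 'M[A]_n) : 'M[A]_(tdim n 1) :=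
  opmx (fun I J => X (I ord0) (J ord0)).

Definition of_op1 (X : 'M[A]_(tdim n 1)) : 'M[A]_n :=
  \matrix_(i, j) opcoef X [ffun=> i] [ffun=> j].

(* X_{s_1 ... s_m} on k factors, for distinct labels 1 <= s_t <= k (with      *)
(* m = size s); for instance embed 3 [:: 2; 3] R is R_{23} on three factors   *)
(* and embed 2 [:: 2; 1] X is X_{21}.  The value for k = 0 is irrelevant.     *)
Definition embed (k : nat) {m : nat} (s : seq nat) (X : 'M[A]_(tdim n m)) :
    'M[A]_(tdim n k) :=
  if k is k'.+1 then
    let pos (t : 'I_m) : 'I_k'.+1 := inord (nth 0%N s t).-1 in
    opmx (fun I J : multi n k'.+1 =>
      opcoef X [ffun t => I (pos t)] [ffun t => J (pos t)]
        *+ [forall c, (c \notin codom pos) ==> (I c == J c)])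
  else 1%:M.

(* The multi-index obtained from I by inserting a at the position t.          *)
Definition insert_at k (t : 'I_k.+1) (a : 'I_n) (I : multi n k) :
    multi n k.+1 :=
  [ffun c => if unlift t c is Some d then I d else a].

(* Trace in the factor labelled i; the remaining factors keep their order.    *)
Definition ptrace k (i : nat) (X : 'M[A]_(tdim n k.+1)) : 'M[A]_(tdim n k) :=
  opmx (fun I J =>
    \sum_(a < n) opcoef X (insert_at (inord i.-1) a I)
                          (insert_at (inord i.-1) a J)).

Definition flip : 'M[A]_(tdim n 2) :=
  opmx (fun I J => ((I ord0 == J ord_max) && (I ord_max == J ord0))%:R).

(* X_{(i -> j)} = X_i X_{i+1} ... X_j if i <= j, X_i X_{i-1} ... X_j if i > j *)
Definition chain k (X : nat -> 'M[A]_(tdim n k)) (i j : nat) :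
    'M[A]_(tdim n k) :=
  if (i <= j)%N then \prod_(t <- index_iota i j.+1) X t
  else \prod_(t <- rev (index_iota j i.+1)) X t.

End TensorOps.

Section HeckeRMatrix.
Context {K : fieldType} {n : nat}.
Implicit Types (q : K) (R Psi : 'M[K]_(tdim n 2)).

Definition qint q (z : int) : K := (q ^ z - q ^ (- z)) / (q - q^-1).

Definition Rat k R (i : nat) : 'M[K]_(tdim n k) := embed k [:: i; i.+1] R.

Definition yang_baxter R : Prop :=
  Rat 3 R 1 *m Rat 3 R 2 *m Rat 3 R 1 = Rat 3 R 2 *m Rat 3 R 1 *m Rat 3 R 2.

Definition hecke q R : Prop := (R - q%:M) *m (R + (q^-1)%:M) = 0.

(* In Tr_{(2)}(R_{12} Psi_{23}) = P_{13} the two factors left are 1 and 3.    *)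
Definition skew_inverse R Psi : Prop :=
  ptrace 2 (embed 3 [:: 1; 2] R *m embed 3 [:: 2; 3] Psi) = flip /\
  ptrace 2 (embed 3 [:: 1; 2] Psi *m embed 3 [:: 2; 3] R) = flip.

(* S^{(k)} and A^{(k)} for k >= 1; the value at k = 0 is irrelevant.          *)
Fixpoint qsym q R (k : nat) : 'M[K]_(tdim n k) :=
  if k is k'.+1 then
    if k' == 0%N then 1%:M else
    let S := embed k'.+1 (iota 2 k') (qsym q R k') in
    (qint q k'.+1)^-1 *:
      (S *m (q ^ (1 - k'.+1%:Z) *: 1%:M + qint q k' *: Rat k'.+1 R 1) *m S)
  else 1%:M.

Fixpoint qasym q R (k : nat) : 'M[K]_(tdim n k) :=
  if k is k'.+1 then
    if k' == 0%N then 1%:M else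
    let S := embed k'.+1 (iota 2 k') (qasym q R k') in
    (qint q k'.+1)^-1 *:
      (S *m (q ^ (k'.+1%:Z - 1) *: 1%:M - qint q k' *: Rat k'.+1 R 1) *m S)
  else 1%:M.

Definition symmetry_rank q R (p : nat) : Prop :=
  [/\ (0 < p)%N, qasym q R p.+1 = 0 & \rank (qasym q R p) = 1%N].

Definition Bmx Psi : 'M[K]_n := of_op1 (ptrace 2 (embed 2 [:: 2; 1] Psi)).

Definition Cmx Psi : 'M[K]_n := of_op1 (ptrace 2 (embed 2 [:: 1; 2] Psi)).

End HeckeRMatrix.

(******************************************************************************)
(* The quotient A / (S) of a K-algebra A by the two-sided ideal generated by  *)
(* a subset S, when 1 is not in this ideal and the scalars are central in A.  *)
(* (The library only has quotients of commutative rings.)                     *)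
(******************************************************************************)

Section AlgebraQuotient.
Context {K : fieldType} {A : lalgType K}.
Implicit Types (x y z : A) (c d : K).

Definition two_sided_ideal (J : A -> Prop) : Prop :=
  [/\ J 0, forall x y, J x -> J y -> J (x - y) &
      forall x y, J x -> J (y * x) /\ J (x * y)].

Variable S : A -> Prop.

Definition ideal_gen (x : A) : bool :=
  `[< forall J, two_sided_ideal J -> (forall y, S y -> J y) -> J x >].

Fact ideal_gen_zmod : zmod_closed ideal_gen.
Proof.
split=> [|x y /asboolP Jx /asboolP Jy]; apply/asboolP => J idJ SJ.
  by case: idJ.
by case: (idJ) => _ subJ _; apply: subJ; [apply: Jx | apply: Jy].
Qed.
HB.instance Definition _ := GRing.isZmodClosed.Build A ideal_gen ideal_gen_zmod.

Fact ideal_genM x y : x \in ideal_gen ->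
  (y * x \in ideal_gen) /\ (x * y \in ideal_gen).
Proof.
move=> /asboolP Jx; split; apply/asboolP => J idJ SJ;
  by case: (idJ) => _ _ /(_ x y (Jx J idJ SJ)) [].
Qed.

Definition scalars_central := forall c x y, c *: (x * y) = x * (c *: y).

Variables (centralA : scalars_central) (properS : 1 \notin ideal_gen).

Definition alg_quot (_ : scalars_central) (_ : 1 \notin ideal_gen) : Type :=
  Quotient.quot (GRing.ZmodClosed.clone A ideal_gen _).
Local Notation Q := (alg_quot centralA properS).
HB.instance Definition _ := GRing.Zmodule.on Q.

Definition to_quot (x : A) : Q :=
  \pi_(Quotient.quot (GRing.ZmodClosed.clone A ideal_gen _)) x.
Definition quot_repr (x : Q) : A :=
  repr (x : Quotient.quot (GRing.ZmodClosed.clone A ideal_gen _)).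

Fact quot_reprK (x : Q) : to_quot (quot_repr x) = x.
Proof. exact: reprK. Qed.

Fact to_quot_surj (x : Q) : exists y, x = to_quot y.
Proof. by exists (quot_repr x); rewrite quot_reprK. Qed.

Fact to_quotP x y : reflect (to_quot x = to_quot y) (x - y \in ideal_gen).
Proof.
rewrite (Quotient.idealrBE (GRing.ZmodClosed.clone A ideal_gen _)).
exact: eqP.
Qed.

Fact to_quotD x y : to_quot (x + y) = to_quot x + to_quot y.
Proof. exact: Quotient.pi_add. Qed.

Fact quot_reprP x : x - quot_repr (to_quot x) \in ideal_gen.
Proof. by apply/to_quotP; rewrite quot_reprK. Qed.

Definition quot_one : Q := to_quot 1.
Definition quot_mul (x y : Q) : Q := to_quot (quot_repr x * quot_repr y).
Definition quot_scale c (x : Q) : Q := to_quot (c *: quot_repr x).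

Fact to_quotM (x y : A) : quot_mul (to_quot x) (to_quot y) = to_quot (x * y).
Proof.
apply/esym/to_quotP; set x' := quot_repr _; set y' := quot_repr _.
have -> : x * y - x' * y' = (x - x') * y + x' * (y - y').
  by rewrite mulrBl mulrBr addrA subrK.
have [_ Jx] := ideal_genM y (quot_reprP x).
have [Jy _] := ideal_genM x' (quot_reprP y).
exact: rpredD.
Qed.

Fact to_quotZ (c : K) (x : A) : quot_scale c (to_quot x) = to_quot (c *: x).
Proof.
apply/esym/to_quotP; rewrite -scalerBr -[_ - _]mul1r scalerAl.
by have [] := ideal_genM (c *: 1) (quot_reprP x).
Qed.

Fact quot_mulA : associative quot_mul.
Proof.
move=> x y z; have [x' ->] := to_quot_surj x; have [y' ->] := to_quot_surj y.
by have [z' ->] := to_quot_surj z; rewrite !to_quotM mulrA.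
Qed.

Fact quot_mul1r : left_id quot_one quot_mul.
Proof. by move=> x; have [x' ->] := to_quot_surj x; rewrite to_quotM mul1r. Qed.

Fact quot_mulr1 : right_id quot_one quot_mul.
Proof. by move=> x; have [x' ->] := to_quot_surj x; rewrite to_quotM mulr1. Qed.

Fact quot_mulDl : left_distributive quot_mul +%R.
Proof.
move=> x y z; have [x' ->] := to_quot_surj x; have [y' ->] := to_quot_surj y.
by have [z' ->] := to_quot_surj z; rewrite -to_quotD !to_quotM mulrDl to_quotD.
Qed.

Fact quot_mulDr : right_distributive quot_mul +%R.
Proof.
move=> x y z; have [x' ->] := to_quot_surj x; have [y' ->] := to_quot_surj y.
by have [z' ->] := to_quot_surj z; rewrite -to_quotD !to_quotM mulrDr to_quotD.
Qed.

Fact quot_one_neq0 : quot_one != 0.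
Proof.
apply: contra properS => /eqP one0.
have z0 : to_quot 0 = 0 by apply: (addrI (to_quot 0)); rewrite -to_quotD !addr0.
by rewrite -[1]subr0; apply/to_quotP; rewrite z0.
Qed.

HB.instance Definition _ := GRing.Zmodule_isNzRing.Build Q
  quot_mulA quot_mul1r quot_mulr1 quot_mulDl quot_mulDr quot_one_neq0.

Fact quot_scaleA c d (x : Q) :
  quot_scale c (quot_scale d x) = quot_scale (c * d) x.
Proof. by have [x' ->] := to_quot_surj x; rewrite !to_quotZ scalerA. Qed.

Fact quot_scale1 : left_id 1 quot_scale.
Proof.
by move=> x; have [x' ->] := to_quot_surj x; rewrite to_quotZ scale1r.
Qed.

Fact quot_scaleDr : right_distributive quot_scale +%R.
Proof.
move=> c x y; have [x' ->] := to_quot_surj x; have [y' ->] := to_quot_surj y.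
by rewrite -to_quotD !to_quotZ scalerDr to_quotD.
Qed.

Fact quot_scaleDl (x : Q) : {morph quot_scale^~ x : c d / c + d}.
Proof.
move=> c d; have [x' ->] := to_quot_surj x.
by rewrite !to_quotZ scalerDl to_quotD.
Qed.

HB.instance Definition _ := GRing.Zmodule_isLmodule.Build K Q
  quot_scaleA quot_scale1 quot_scaleDr quot_scaleDl.

Fact quot_scaleAl (c : K) (x y : Q) : c *: (x * y) = (c *: x) * y.
Proof.
have [x' ->] := to_quot_surj x; have [y' ->] := to_quot_surj y.
by rewrite /GRing.mul /GRing.scale /= !(to_quotM, to_quotZ) scalerAl.
Qed.

HB.instance Definition _ := GRing.Lmodule_isLalgebra.Build K Q quot_scaleAl.

Fact quot_scaleAr (c : K) (x y : Q) : c *: (x * y) = x * (c *: y).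
Proof.
have [x' ->] := to_quot_surj x; have [y' ->] := to_quot_surj y.
by rewrite /GRing.mul /GRing.scale /= !(to_quotM, to_quotZ) centralA.
Qed.

HB.instance Definition _ := GRing.Lalgebra_isAlgebra.Build K Q quot_scaleAr.

End AlgebraQuotient.

(******************************************************************************)
(* The modified reflection equation algebra L_q: the quotient of the free     *)
(* associative algebra on the letters (i, j) by the two-sided ideal generated *)
(* by the entries of                                                          *)
(*    R_{12} L_1 R_{12} L_1 - L_1 R_{12} L_1 R_{12} - R_{12} L_1 + L_1 R_{12} *)
(******************************************************************************)

Section REA.
Context {K : fieldType} {n : nat}.

Definition freeREA : Type := {malg K[{fmonom ('I_n * 'I_n)%type}]}.
HB.instance Definition _ := GRing.Lalgebra.on freeREA.

Definition free_gen : 'M[freeREA]_n :=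
  \matrix_(i, j) (<< fmu (i, j) >> : {malg K[{fmonom ('I_n * 'I_n)%type}]}).

Definition scal_mx {A : lalgType K} {m1 m2} (X : 'M[K]_(m1, m2)) :
  'M[A]_(m1, m2) := map_mx (in_alg A) X.

Variable R : 'M[K]_(tdim n 2).

Definition rea_relator : 'M[freeREA]_(tdim n 2) :=
  let R12 := scal_mx R in
  let L1 := embed 2 [:: 1] (op1 free_gen) in
  R12 *m L1 *m R12 *m L1 - L1 *m R12 *m L1 *m R12 - (R12 *m L1 - L1 *m R12).

Definition rea_relation (x : freeREA) : Prop := exists a b, x = rea_relator a b.

Fact free_central : @scalars_central K freeREA.
Proof.
move=> c x y.
suff comm_c (z : freeREA) : z * c%:MP = c *: z.
  by rewrite -(mul_malgC c y) mulrA comm_c scalerAl.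
rewrite (monalgE z) mulr_suml scaler_sumr; apply: eq_bigr => k _.
rewrite malgM_def fgmulUU mulm1; apply/malgP => k'.
by rewrite mcoeffZ !mcoeffU mulrnAr [_ * c]mulrC.
Qed.

Definition augm : freeREA -> K :=
  @mcoeff _ K (mone : {fmonom ('I_n * 'I_n)%type}).

Fact augm_zmod : zmod_morphism augm.
Proof. by move=> x y; rewrite /augm raddfB. Qed.
HB.instance Definition _ := GRing.isZmodMorphism.Build freeREA K augm augm_zmod.

Fact augm_monoid : monoid_morphism augm.
Proof.
split; first exact: (rmorph1 (@mcoeff {fmonom ('I_n * 'I_n)%type} K mone)).
exact: (rmorphM (@mcoeff {fmonom ('I_n * 'I_n)%type} K mone)).
Qed.
HB.instance Definition _ :=
  GRing.isMonoidMorphism.Build freeREA K augm augm_monoid.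

Fact rea_proper : (1 : freeREA) \notin ideal_gen rea_relation.
Proof.
have augm_L : map_mx augm (embed 2 [:: 1] (op1 free_gen)) = 0.
  have augm_gen i j : augm (free_gen i j) = 0.
    rewrite mxE /augm mcoeffU1 (_ : (_ == _) = false) //.
    by apply/eqP => /(congr1 (@fmonom_val _)); rewrite fm1 fmuE.
  by apply/matrixP => a b; rewrite !mxE raddfMn /opcoef mxE /= augm_gen mul0rn.
apply/negP => /asboolP J1.
suff /eqP : augm 1 = 0 by rewrite rmorph1 oner_eq0.
apply: (J1 (fun x => augm x = 0)) => [|_ [a [b ->]]].
  split=> [|x y x0 y0|x y x0]; first exact: rmorph0.
    by rewrite [LHS]augm_zmod x0 y0 subrr.
  by split; rewrite [LHS](snd augm_monoid) x0 (mulr0, mul0r).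
pose J (x : freeREA) := augm x = 0.
have JB x y : J x -> J y -> J (x - y).
  by move=> x0 y0; rewrite /J [LHS]augm_zmod x0 y0 subrr.
have Jsum (F : 'I_(tdim n 2) -> freeREA) :
    (forall c, J (F c)) -> J (\sum_c F c).
  move=> JF; apply: (big_ind J) => //; first exact: rmorph0.
  move=> x y x0 y0; rewrite -[y]opprK; apply: (JB) => //.
  by rewrite -sub0r; apply: (JB) => //; apply: rmorph0.
have JM x y : J x \/ J y -> J (x * y).
  move=> xy0; rewrite /J [LHS](snd augm_monoid).
  by case: xy0 => ->; rewrite (mul0r, mulr0).
have JMl (X Y : 'M[freeREA]_(tdim n 2)) :
  (forall i j, J (X i j)) -> forall i j, J ((X *m Y) i j).
  by move=> JX i j; rewrite mxE; apply: Jsum => c; apply: JM; left.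
have JMr (X Y : 'M[freeREA]_(tdim n 2)) :
  (forall i j, J (Y i j)) -> forall i j, J ((X *m Y) i j).
  by move=> JX i j; rewrite mxE; apply: Jsum => c; apply: JM; right.
have JBm (X Y : 'M[freeREA]_(tdim n 2)) : (forall i j, J (X i j)) ->
  (forall i j, J (Y i j)) -> forall i j, J ((X - Y) i j).
  by move=> JX JY i j; rewrite mxE [X in _ + X]mxE; apply: (JB).
have JL i j : J (embed 2 [:: 1] (op1 free_gen) i j).
  by have /matrixP/(_ i j) := augm_L; rewrite [LHS]mxE [RHS]mxE.
rewrite /rea_relator; move: (embed _ _ _) (scal_mx R) JL => L1 R12 JL.
by apply: (JBm); apply: (JBm);
  [apply: (JMr)|apply: (JMl); apply: (JMr)|apply: (JMr)|apply: (JMl)].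
Qed.

Definition REA : Type := alg_quot free_central rea_proper.
HB.instance Definition _ := GRing.Algebra.on REA.

Definition Lmx : 'M[REA]_n :=
  map_mx (to_quot free_central rea_proper) free_gen.

Definition Tr_q (Psi : 'M[K]_(tdim n 2)) (X : 'M[REA]_n) : REA :=
  \tr (scal_mx (Cmx Psi) *m X).

Definition s_elt (Psi : 'M[K]_(tdim n 2)) (m : nat) : REA :=
  Tr_q Psi (Lmx ^+ m).
End REA.

(******************************************************************************)
(* A vector of V^{(x)k} is the row v of its coordinates in the basis e_I, so  *)
(* a numerical matrix X acts by X |> v = v *m X, and X |> V^{(x)k} is the row *)
(* space of X.  An operator tau(x) acts on v as v *m tau^t(x); in particular  *)
(* tau^t(x y) = tau^t(y) *m tau^t(x).                                         *)
(******************************************************************************)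

Section Modules.
Context {K : fieldType} {n : nat}.
Variables (q : K) (R Psi : 'M[K]_(tdim n 2)).

(* pi(l_i^j) e_a = B_a^j e_i                                                  *)
Definition pi_t (i j : 'I_n) : 'M[K]_n :=
  \matrix_(a, b) (Bmx Psi a j *+ (b == i)).

Definition pi1_t (k : nat) (i j : 'I_n) : 'M[K]_(tdim n k) :=
  embed k [:: 1%N] (op1 (pi_t i j)).

Definition rho_t (k : nat) (i j : 'I_n) : 'M[K]_(tdim n k) :=
  let Rinv (t : nat) := invmx (Rat k R t) in
  pi1_t k i j +
  \sum_(1 <= s < k) chain Rinv s 1 *m pi1_t k i j *m chain Rinv 1 s.

Definition pi_sym_t (k : nat) (i j : 'I_n) : 'M[K]_(tdim n k) :=
  qsym q R k *m rho_t k i j *m qsym q R k.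

Definition pi_asym_t (k : nat) (i j : 'I_n) : 'M[K]_(tdim n k) :=
  qasym q R k *m rho_t k i j *m qasym q R k.

(* tau is x |-> tau^t(x) for a representation of L_q in the subspace          *)
(* E |> V^{(x)k}, where E is idempotent, with tau^t(l_i^j) = g i j.  An       *)
(* operator of the subspace is embedded in End(V^{(x)k}) by composition with  *)
(* the projector E; hence the unit of L_q is represented by E.                *)
Definition represents (k : nat) (E : 'M[K]_(tdim n k))
    (g : 'I_n -> 'I_n -> 'M[K]_(tdim n k)) (tau : REA R -> 'M[K]_(tdim n k)) :=
  [/\ linear tau, tau 1 = E, forall x y, tau (x * y) = tau y *m tau x &
      forall i j, tau (Lmx R i j) = g i j].

End Modules.

(* Main.v *)
From Pilot Require Import Defs.
From HB Require Import structures.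
From mathcomp Require Import all_boot all_order all_algebra.
From mathcomp Require Import reals complex ring zify.

Set Implicit Arguments.
Unset Strict Implicit.
Unset Printing Implicit Defensive.

Import GRing.Theory.
Local Open Scope ring_scope.

(** Write pi for the matrix of a generator on one tensor factor.  Its entries
    are B_a^j delta_b^i: with the two indices of the generator read as those of
    an auxiliary space, it is a tensor of rank one; part (ii) rests on this.

    (i) The q-symmetrizer S absorbs every R_i, with factor q (qsym_absorbs),
    hence every R_i^{-1} with factor q^{-1}.  So S absorbs the chains of rho_k^t
    on both sides, and the k summands become q^{-2s} S pi S, whose sum is
    the q-number of the statement (pi_sym_tE).

    (ii) Because pi has rank one, the products that make up L^m close a loop in
    the first factor:
      sum_a pi(a,j) S pi(i,a) = pi(i,j) Tr_1(B_1 S)_{2..k}  (pi1_t_contract).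
    The recursion that defines S, with Tr_1(B_1 R_{12}) = I, gives that
    Tr_1(B_1 S^{(k)}) is a multiple of S^{(k-1)} (Btrace_qsym), which S
    absorbs.  Hence L^m acts as a multiple of S pi S, and the final trace with C
    replaces pi by the matrix B C (tau_s_elt).

    It remains to know Tr B and B C, which depend on R.  Tracing
    A^{(p+1)} = 0 over its first factor gives a multiple of A^{(p)}, which is
    not zero, so this multiple vanishes, and that determines Tr B.  For B C,
    trace the Yang-Baxter equation against C over the third factor: with the
    Hecke relation this reads
      Tr_3(R_{23} R_{12} R_{23} C_3) = I + (q - q^{-1}) R_{12}.
    Removing R_{12} by means of Psi and then tracing against B turns the left
    side into I and the right side into B C + (q - q^{-1}) Tr B (BC_scalar).

    The antisymmetric case is the symmetric one for the parameter - q^{-1}: the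
    Hecke relation is invariant under q -> - q^{-1}, and this substitution
    turns the recursion of the q-symmetrizers into that of the
    q-antisymmetrizers (hecke_dual, qasym_dual). *)

(* The name Rat also belongs to the constructor of rational numbers. *)
Local Notation Rat := Pilot.Defs.Rat.

(** * Block decomposition along the first tensor factor *)

Section Blocks.
Context {A : pzRingType} {n : nat}.

Definition icons k (a : 'I_n) (I : multi n k) : multi n k.+1 :=
  insert_at ord0 a I.

Definition itail k (I : multi n k.+1) : multi n k := [ffun c => I (lift ord0 c)].

Lemma icons0 k a (I : multi n k) : icons a I ord0 = a.
Proof. by rewrite ffunE unlift_none. Qed.

Lemma iconsS k a (I : multi n k) c : icons a I (lift ord0 c) = I c.
Proof. by rewrite ffunE liftK. Qed.

Lemma icons_itail k (I : multi n k.+1) : icons (I ord0) (itail I) = I.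
Proof.
by apply/ffunP => c; case: (unliftP ord0 c) => [d|] ->; rewrite (icons0, iconsS) ?ffunE.
Qed.

Lemma itail_icons k a (I : multi n k) : itail (icons a I) = I.
Proof. by apply/ffunP => c; rewrite ffunE iconsS. Qed.

Lemma eq_icons k a b (I J : multi n k) :
  (icons a I == icons b J) = (a == b) && (I == J).
Proof.
apply/eqP/andP => [eIJ | [/eqP-> /eqP->] //].
by rewrite -(icons0 a I) eIJ icons0 -(itail_icons a I) eIJ itail_icons !eqxx.
Qed.

Lemma sum_multiS (M : nmodType) k (F : multi n k.+1 -> M) :
  \sum_I F I = \sum_a \sum_I F (icons a I).
Proof.
rewrite pair_big /=.
rewrite (reindex (fun u : 'I_n * multi n k => icons u.1 u.2)) //=.
exists (fun I : multi n k.+1 => (I ord0, itail I)) => [[a I] _ | I _] /=.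
  by rewrite icons0 itail_icons.
exact: icons_itail.
Qed.

Lemma opcoef_opmx k (f : multi n k -> multi n k -> A) I J :
  opcoef (opmx f) I J = f I J.
Proof. by rewrite /opcoef mxE !enum_rankK. Qed.

Lemma opcoefP k (X Y : 'M[A]_(tdim n k)) :
  (forall I J, opcoef X I J = opcoef Y I J) -> X = Y.
Proof.
by move=> eXY; apply/matrixP => a b; have := eXY (enum_val a) (enum_val b);
  rewrite /opcoef !enum_valK.
Qed.

Lemma opcoefM k (X Y : 'M[A]_(tdim n k)) I J :
  opcoef (X *m Y) I J = \sum_H opcoef X I H * opcoef Y H J.
Proof.
rewrite /opcoef mxE (reindex (@enum_rank (multi n k))) //=.
by apply: onW_bij; apply: enum_rank_bij.
Qed.

Lemma opcoef_scalar k (c : A) (I J : multi n k) :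
  opcoef c%:M I J = c *+ (I == J).
Proof. by rewrite /opcoef mxE (inj_eq enum_rank_inj). Qed.

(** A matrix on k + 1 factors is handled as an n x n array of matrices on k
    factors.  Embeddings, shifts and traces over the first factor are transparent
    in this form, which is what makes induction on the number of factors work. *)
Definition blk k (X : 'M[A]_(tdim n k.+1)) (a b : 'I_n) : 'M[A]_(tdim n k) :=
  opmx (fun I J => opcoef X (icons a I) (icons b J)).

Lemma opcoef_blk k (X : 'M[A]_(tdim n k.+1)) a b I J :
  opcoef (blk X a b) I J = opcoef X (icons a I) (icons b J).
Proof. exact: opcoef_opmx. Qed.

Lemma blkP k (X Y : 'M[A]_(tdim n k.+1)) :
  (forall a b, blk X a b = blk Y a b) -> X = Y.
Proof.
move=> eXY; apply: opcoefP => I J.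
have /(congr1 (fun Z => opcoef Z (itail I) (itail J))) := eXY (I ord0) (J ord0).
by rewrite !opcoef_opmx !icons_itail.
Qed.

Lemma blkM k (X Y : 'M[A]_(tdim n k.+1)) a b :
  blk (X *m Y) a b = \sum_c blk X a c *m blk Y c b.
Proof.
apply: opcoefP => I J; rewrite opcoef_opmx opcoefM sum_multiS.
rewrite /opcoef summxE; apply: eq_bigr => c _.
rewrite -/(opcoef (_ *m _) I J) opcoefM; apply: eq_bigr => H _.
by rewrite !opcoef_opmx.
Qed.

Lemma blk_scalar k (c : A) a b :
  blk (c%:M : 'M[A]_(tdim n k.+1)) a b = c%:M *+ (a == b).
Proof.
apply: opcoefP => I J; rewrite opcoef_opmx opcoef_scalar eq_icons.
by rewrite -raddfMn opcoef_scalar -mulrnA mulnb.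
Qed.

Lemma blkD k (X Y : 'M[A]_(tdim n k.+1)) a b :
  blk (X + Y) a b = blk X a b + blk Y a b.
Proof. by apply/matrixP => I J; rewrite !mxE /opcoef !mxE. Qed.

Lemma blkMn k (X : 'M[A]_(tdim n k.+1)) m a b : blk (X *+ m) a b = blk X a b *+ m.
Proof. by apply/matrixP => I J; rewrite mulmxnE !mxE /opcoef mulmxnE. Qed.

Lemma blkZ k c (X : 'M[A]_(tdim n k.+1)) a b :
  blk (c *: X) a b = c *: blk X a b.
Proof. by apply/matrixP => I J; rewrite !mxE /opcoef !mxE. Qed.

Lemma blk_sum k T (r : seq T) (F : T -> 'M[A]_(tdim n k.+1)) a b :
  blk (\sum_(t <- r) F t) a b = \sum_(t <- r) blk (F t) a b.
Proof.
apply/matrixP => I J; rewrite mxE /opcoef !summxE.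
by apply: eq_bigr => t _; rewrite mxE.
Qed.

Definition embed_pos k m (s : seq nat) (t : 'I_m) : 'I_k.+1 :=
  inord (nth 0%N s t).-1.

Lemma opcoef_embed k m (s : seq nat) (X : 'M[A]_(tdim n m)) (I J : multi n k.+1) :
  let pos := @embed_pos k m s in
  opcoef (embed k.+1 s X) I J =
  opcoef X [ffun t => I (pos t)] [ffun t => J (pos t)]
        *+ [forall c, (c \notin codom pos) ==> (I c == J c)].
Proof. by rewrite opcoef_opmx. Qed.

(** Moving all labels up by one tensors with the identity on the left: no label
    then refers to the first factor. *)
Lemma blk_embed_succ k m (s : seq nat) (X : 'M[A]_(tdim n m)) a b :
  size s = m -> all (fun i => (0 < i <= k.+1)%N) s ->
  blk (embed k.+2 (map succn s) X) a b = embed k.+1 s X *+ (a == b).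
Proof.
move=> size_s /allP s_ok; apply: opcoefP => I J.
rewrite opcoef_opmx opcoef_embed.
have -> : opcoef (embed k.+1 s X *+ (a == b)) I J =
          opcoef (embed k.+1 s X) I J *+ (a == b).
  by rewrite /opcoef mulmxnE.
rewrite opcoef_embed -mulrnA mulnb.
set pos := @embed_pos k.+1 m _.
set pos' := @embed_pos k m s.
have posE t : pos t = lift ord0 (pos' t).
  have /s_ok/andP[s_gt0 s_le] : nth 0%N s t \in s by rewrite mem_nth ?size_s.
  apply: val_inj; rewrite /= /bump /= add1n /pos /pos' /embed_pos.
  rewrite (nth_map 0%N) ?size_s //=.
  by rewrite !inordK ?prednK.
congr (_ *+ _).
  by congr opcoef; apply/ffunP => t; rewrite [LHS]ffunE [RHS]ffunE posE iconsS.
congr (nat_of_bool _); apply/forallP/andP => [eIJ | [/forallP eIJ eab] c].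
  split; last first.
    have /implyP := eIJ ord0; rewrite !icons0; apply.
    by apply/codomP => -[t]; rewrite posE => /eqP; rewrite (negPf (neq_lift _ _)).
  apply/forallP => c; apply/implyP => c_pos.
  have /implyP := eIJ (lift ord0 c); rewrite !iconsS; apply.
  apply: contra c_pos => /codomP[t]; rewrite posE => /lift_inj ->.
  exact: codom_f.
apply/implyP; case: (unliftP ord0 c) => [d|] -> c_pos; rewrite ?icons0 //.
rewrite !iconsS; apply: (implyP (eIJ d)); apply: contra c_pos => /codomP[t ->].
by rewrite -posE codom_f.
Qed.

Lemma embed_iota1 k (X : 'M[A]_(tdim n k.+1)) : embed k.+1 (iota 1 k.+1) X = X.
Proof.
apply: opcoefP => I J; rewrite opcoef_embed.
set pos := @embed_pos k _ _.
have posE t : pos t = t by rewrite /pos /embed_pos nth_iota // add1n inord_val.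
rewrite (_ : [forall c, _]); last first.
  by apply/forallP => c; rewrite -{1}(posE c) codom_f.
by congr opcoef; apply/ffunP => t; rewrite ffunE posE.
Qed.
End Blocks.

(** * Shifts, and R acting in the first two factors *)

Section Tensor.
Context {K : fieldType} {n : nat}.

Definition unblk k (F : 'I_n -> 'I_n -> 'M[K]_(tdim n k)) : 'M[K]_(tdim n k.+1) :=
  opmx (fun I J => opcoef (F (I ord0) (J ord0)) (itail I) (itail J)).

Lemma unblkK k (F : 'I_n -> 'I_n -> 'M[K]_(tdim n k)) a b : blk (unblk F) a b = F a b.
Proof. by apply: opcoefP => I J; rewrite !opcoef_opmx !icons0 !itail_icons. Qed.

(** I (x) X *)
Definition shift k (X : 'M[K]_(tdim n k)) := unblk (fun a b => X *+ (a == b)).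

Lemma blk_shift k (X : 'M[K]_(tdim n k)) a b : blk (shift X) a b = X *+ (a == b).
Proof. exact: unblkK. Qed.

Lemma sum_deltal (M : nmodType) (F : 'I_n -> M) a :
  \sum_c F c *+ (a == c) = F a.
Proof.
rewrite (bigD1 a) //= eqxx big1 ?addr0 // => c.
by rewrite eq_sym => /negPf->.
Qed.

Lemma sum_deltar (M : nmodType) (F : 'I_n -> M) a :
  \sum_c F c *+ (c == a) = F a.
Proof. by rewrite -[RHS]sum_deltal; apply: eq_bigr => c _; rewrite eq_sym. Qed.

Lemma blk_shiftM k (X : 'M[K]_(tdim n k)) Y a b :
  blk (shift X *m Y) a b = X *m blk Y a b.
Proof.
rewrite blkM (eq_bigr (fun c => (X *m blk Y c b) *+ (a == c))) ?sum_deltal // => c _.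
by rewrite blk_shift mulmxE mulrnAl.
Qed.

Lemma blkM_shift k (X : 'M[K]_(tdim n k)) Y a b :
  blk (Y *m shift X) a b = blk Y a b *m X.
Proof.
rewrite blkM (eq_bigr (fun c => (blk Y a c *m X) *+ (c == b))) ?sum_deltar // => c _.
by rewrite blk_shift mulmxE mulrnAr.
Qed.

Lemma shiftM k (X Y : 'M[K]_(tdim n k)) : shift (X *m Y) = shift X *m shift Y.
Proof.
by apply: blkP => a b; rewrite blk_shiftM !blk_shift mulmxE mulrnAr.
Qed.

Lemma shiftD k (X Y : 'M[K]_(tdim n k)) : shift (X + Y) = shift X + shift Y.
Proof. by apply: blkP => a b; rewrite blkD !blk_shift mulrnDl. Qed.

Lemma shiftZ k c (X : 'M[K]_(tdim n k)) : shift (c *: X) = c *: shift X.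
Proof. by apply: blkP => a b; rewrite blkZ !blk_shift scalerMnr. Qed.

Lemma shift_scalar k c : shift (c%:M : 'M[K]_(tdim n k)) = c%:M.
Proof. by apply: blkP => a b; rewrite blk_scalar blk_shift. Qed.

Lemma embed_shift k (X : 'M[K]_(tdim n k.+1)) :
  embed k.+2 (iota 2 k.+1) X = shift X.
Proof.
apply: blkP => a b; rewrite blk_shift -(embed_iota1 X) -(map_id (iota 2 _)).
rewrite -[2%N]/(1 + 1)%N iotaDl -map_comp (@eq_map _ _ _ succn) //.
rewrite {1}embed_iota1; rewrite blk_embed_succ ?size_iota //.
by apply/allP => i; rewrite mem_iota add1n ltnS.
Qed.

Lemma opcoef_embed_iota1 k m (X : 'M[K]_(tdim n m)) (I J : multi n k.+1) :
  (m <= k.+1)%N ->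
  opcoef (embed k.+1 (iota 1 m) X) I J =
  opcoef X [ffun t : 'I_m => I (inord t)] [ffun t : 'I_m => J (inord t)]
     *+ [forall c : 'I_k.+1, (m <= c)%N ==> (I c == J c)].
Proof.
move=> le_mk; rewrite opcoef_embed; set pos := @embed_pos _ _ _.
have posE (t : 'I_m) : pos t = inord t by rewrite /pos /embed_pos nth_iota.
congr (_ *+ _); first by congr opcoef; apply/ffunP => t; rewrite !ffunE posE.
congr nat_of_bool; apply: eq_forallb => c; congr (_ ==> _).
rewrite leqNgt; congr (~~ _); apply/codomP/idP => [[t ->]|lt_cm].
  by rewrite posE inordK // (leq_trans (ltn_ord t)).
by exists (Ordinal lt_cm); rewrite posE inord_val.
Qed.

Definition index1 (a : 'I_n) : multi n 1 := [ffun=> a].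
Definition index2 (a b : 'I_n) : multi n 2 := icons a (index1 b).

Lemma sum_multi1 (M : nmodType) (F : multi n 1 -> M) :
  \sum_I F I = \sum_a F (index1 a).
Proof.
rewrite (reindex index1) //=.
exists (fun I : multi n 1 => I ord0) => [a|I] _; first by rewrite ffunE.
by apply/ffunP => c; rewrite ffunE (ord1 c).
Qed.

Lemma index1_eq a b : (index1 a == index1 b) = (a == b).
Proof. by apply/eqP/eqP => [/ffunP/(_ ord0)|->//]; rewrite !ffunE. Qed.

Lemma index2_eq a b c d : (index2 a b == index2 c d) = (a == c) && (b == d).
Proof. by rewrite eq_icons index1_eq. Qed.

Lemma sum_multi2 (M : nmodType) (F : multi n 2 -> M) :
  \sum_I F I = \sum_a \sum_b F (index2 a b).
Proof. by rewrite sum_multiS; apply: eq_bigr => a _; rewrite sum_multi1. Qed.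

(** X_{ab}^{cd}: lower indices a, b and upper indices c, d. *)
Definition entry (X : 'M[K]_(tdim n 2)) a b c d := opcoef X (index2 a b) (index2 c d).

Lemma entryM X Y a b c d : entry (X *m Y) a b c d =
  \sum_e \sum_f entry X a b e f * entry Y e f c d.
Proof. by rewrite /entry opcoefM sum_multi2. Qed.

Lemma Rat12 (R : 'M[K]_(tdim n 2)) : Rat 2 R 1 = R.
Proof. exact: (@embed_iota1 K n 1). Qed.

Lemma blk_Rat1 k (R : 'M[K]_(tdim n 2)) a b c d :
  blk (blk (Rat k.+2 R 1) a c) b d = (entry R a b c d)%:M.
Proof.
apply: opcoefP => I J; rewrite !opcoef_blk opcoef_scalar.
rewrite (_ : Rat _ _ _ = embed k.+2 (iota 1 2) R) // opcoef_embed_iota1 //.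
have two x y (H : multi n k) :
    [ffun t : 'I_2 => icons x (icons y H) (inord t)] = index2 x y.
  have inord0 : inord (@ord0 1) = ord0 :> 'I_k.+2.
    by apply: val_inj; rewrite /= inordK.
  have inord1 : inord (lift (@ord0 1) ord0) = lift ord0 ord0 :> 'I_k.+2.
    by apply: val_inj; rewrite /= inordK.
  apply/ffunP => t; rewrite [LHS]ffunE; case: (unliftP ord0 t) => [u|] ->.
    by rewrite (ord1 u) inord1 !iconsS icons0 ffunE.
  by rewrite inord0 !icons0.
rewrite !two /entry; congr (_ *+ nat_of_bool _).
apply/forallP/eqP => [eIJ | -> x].
  apply/ffunP => x; have /implyP/(_ isT) := eIJ (lift ord0 (lift ord0 x)).
  by rewrite !iconsS => /eqP.
apply/implyP; case: (unliftP ord0 x) => [y|] -> //.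
by case: (unliftP ord0 y) => [z|] -> //; rewrite !iconsS.
Qed.

Lemma blk_embed1 k (M : 'M[K]_n) a b :
  blk (embed k.+1 [:: 1%N] (op1 M)) a b = (M a b)%:M.
Proof.
apply: opcoefP => I J; rewrite opcoef_blk opcoef_scalar.
rewrite (_ : embed _ _ _ = embed k.+1 (iota 1 1) (op1 M)) //.
rewrite opcoef_embed_iota1 // opcoef_opmx !ffunE.
have -> : inord (@ord0 0) = ord0 :> 'I_k.+1 by apply: val_inj; rewrite /= inordK.
rewrite !unlift_none; congr (_ *+ nat_of_bool _).
apply/forallP/eqP => [eIJ | -> x].
  apply/ffunP => x; have /implyP/(_ isT) := eIJ (lift ord0 x).
  by rewrite !iconsS => /eqP.
by apply/implyP; case: (unliftP ord0 x) => [y|] -> //; rewrite !iconsS.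
Qed.

Lemma Rat_succ k (R : 'M[K]_(tdim n 2)) i :
  (i.+1 < k)%N -> Rat k.+1 R i.+2 = shift (Rat k R i.+1).
Proof.
case: k => // k lt_ik; apply: blkP => a b; rewrite blk_shift /Defs.Rat.
rewrite -[[:: i.+2; i.+3]]/(map succn [:: i.+1; i.+2]) blk_embed_succ //=.
by rewrite !ltnS in lt_ik *; rewrite lt_ik andbT ltnW.
Qed.

Lemma Rat1_scalar k c : Rat k.+2 (c%:M : 'M[K]_(tdim n 2)) 1 = c%:M.
Proof.
apply: blkP => a b; apply: blkP => c' d; rewrite blk_Rat1 /entry opcoef_scalar index2_eq.
by rewrite blk_scalar blkMn blk_scalar -mulrnA mulnb andbC -raddfMn.
Qed.

Lemma Rat1_0 k : Rat k.+2 (0 : 'M[K]_(tdim n 2)) 1 = 0.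
Proof. by rewrite -(raddf0 (@scalar_mx K (tdim n 2))) Rat1_scalar raddf0. Qed.

Lemma Rat1D k (X Y : 'M[K]_(tdim n 2)) :
  Rat k.+2 (X + Y) 1 = Rat k.+2 X 1 + Rat k.+2 Y 1.
Proof.
apply: blkP => a b; apply: blkP => c d; rewrite !blkD !blk_Rat1 -raddfD.
by rewrite /entry /opcoef mxE.
Qed.

Lemma Rat1M k (X Y : 'M[K]_(tdim n 2)) :
  Rat k.+2 (X *m Y) 1 = Rat k.+2 X 1 *m Rat k.+2 Y 1.
Proof.
apply: blkP => a b; apply: blkP => c d; rewrite !blkM blk_sum !blk_Rat1 entryM raddf_sum.
apply: eq_bigr => e _; rewrite blkM raddf_sum; apply: eq_bigr => f _.
by rewrite !blk_Rat1 -scalar_mxM.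
Qed.

(** The two sides act in complementary factors. *)
Lemma Rat1_shift2 k (R : 'M[K]_(tdim n 2)) (X : 'M[K]_(tdim n k)) :
  Rat k.+2 R 1 *m shift (shift X) = shift (shift X) *m Rat k.+2 R 1.
Proof.
apply: blkP => a b; apply: blkP => c d.
by rewrite blkM_shift blk_shiftM blkM_shift blk_shiftM !blk_Rat1 scalar_mxC.
Qed.

(** X (x) I on k + 3 factors.  This is multiplicative, so it carries the
    Yang-Baxter equation from three factors to any larger number. *)
Definition front3 k (X : 'M[K]_(tdim n 3)) : 'M[K]_(tdim n k.+3) :=
  unblk (fun a b => Rat k.+2 (blk X a b) 1).

Lemma front3M k X Y : front3 k (X *m Y) = front3 k X *m front3 k Y.
Proof.
apply: blkP => a b; rewrite blkM !unblkK blkM.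
rewrite (big_morph (fun Z => Rat k.+2 Z 1) (@Rat1D k) (Rat1_0 k)).
by apply: eq_bigr => c _; rewrite !unblkK Rat1M.
Qed.

Lemma entry_blk_Rat1 R a b c d e f :
  entry (blk (Rat 3 R 1) a b) c e d f = entry R a c b d *+ (e == f).
Proof.
have /(congr1 (fun X => opcoef X (index1 e) (index1 f))) := blk_Rat1 1 R a c b d.
by rewrite opcoef_opmx opcoef_scalar index1_eq.
Qed.

Lemma front3_Rat1 k R : front3 k (Rat 3 R 1) = Rat k.+3 R 1.
Proof.
apply: blkP => a b; apply: blkP => c d; rewrite unblkK blk_Rat1.
by apply: blkP => e f; rewrite blk_Rat1 entry_blk_Rat1 blk_scalar -raddfMn.
Qed.

Lemma front3_Rat2 k R : front3 k (Rat 3 R 2) = Rat k.+3 R 2.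
Proof.
apply: blkP => a b; rewrite unblkK !Rat_succ // !blk_shift Rat12.
by case: (a == b); rewrite // Rat1_0.
Qed.

Lemma yang_baxter_front k (R : 'M[K]_(tdim n 2)) : yang_baxter R ->
  Rat k.+3 R 1 *m Rat k.+3 R 2 *m Rat k.+3 R 1 =
  Rat k.+3 R 2 *m Rat k.+3 R 1 *m Rat k.+3 R 2.
Proof.
by move=> /(congr1 (front3 k)); rewrite !front3M front3_Rat1 front3_Rat2.
Qed.

Lemma hecke_Rat1 k q (R : 'M[K]_(tdim n 2)) : hecke q R ->
  (Rat k.+2 R 1 - q%:M) *m (Rat k.+2 R 1 + (q^-1)%:M) = 0.
Proof.
move=> /(congr1 (fun X => Rat k.+2 X 1)).
rewrite Rat1_0 Rat1M -raddfN.
by rewrite !Rat1D !Rat1_scalar raddfN.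
Qed.

End Tensor.

(** * q-numbers *)

Section Qint.
Context {K : fieldType}.
Variable q : K.
Hypothesis q_neq0 : q != 0.
Hypothesis qint_neq0 : forall k : nat, (0 < k)%N -> qint q k != 0.

Lemma lambda_neq0 : q - q^-1 != 0.
Proof.
apply: contra_neq (qint_neq0 (ltn0Sn 0)) => lam0.
by rewrite /qint lam0 invr0 mulr0.
Qed.

Lemma exprz_1sub (k : nat) : q ^ (1 - k.+1%:Z) = (q ^+ k)^-1.
Proof. by rewrite (_ : 1 - k.+1%:Z = - k%:Z) ?exprnN //; lia. Qed.

Lemma qint_nat (k : nat) : qint q k = (q ^+ k - (q ^+ k)^-1) / (q - q^-1).
Proof. by rewrite /qint -exprnN. Qed.

Lemma qint0 : qint q 0 = 0.
Proof. by rewrite qint_nat expr0 invr1 subrr mul0r. Qed.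

Lemma qint1 : qint q 1 = 1.
Proof. by rewrite qint_nat expr1 divff ?lambda_neq0. Qed.

Lemma q2_neq1 : q ^+ 2 - 1 != 0.
Proof.
have := lambda_neq0; apply: contra_neq => e.
by apply: (mulfI q_neq0); rewrite mulrBr divff // -expr2 e mulr0.
Qed.

Lemma qintS (k : nat) : qint q k.+1 = q * qint q k + (q ^+ k)^-1.
Proof.
rewrite !qint_nat exprS; have := q2_neq1; rewrite expr2 => q2; field.
by rewrite q_neq0 q2 expf_neq0.
Qed.

(** The two chains around the s-th summand of rho_k^t contribute q^{-s} each. *)
Lemma sum_qV (k : nat) :
  \sum_(0 <= s < k) (q^-1) ^+ s * (q^-1) ^+ s = q ^ (1 - k%:Z) * qint q k.
Proof.
elim: k => [|k IHk]; first by rewrite big_geq // qint0 mulr0.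
rewrite big_nat_recr //= IHk exprz_1sub qintS; case: k {IHk} => [|k].
  by rewrite qint0 !expr0 !mulr0 invr1 !add0r.
by rewrite exprz_1sub !exprVn exprS; field; rewrite q_neq0 expf_neq0.
Qed.
End Qint.

(** * q-symmetrizers *)

Section SymmetrizerStep.
Context {K : fieldType}.

(** The step that shows R_1 S = q S for the next symmetrizer
    S = E (a + b R_1) E, where E is the previous one, moved to the factors 2..k,
    and F the one before, moved to the factors 3..k, so that F commutes with R_1.
    Put T = R_1 - q.  Expanding the left E in terms of F moves T next to
    (c + d R_2) (a + b R_1) E.  There T R_1 = - q^{-1} T and R_2 E = q E, while
    T R_2 R_1 E = 0 by the Yang-Baxter equation; what is left is a multiple of
    T E whose coefficient is zero. *)
Lemma symmetrizer_step N (q a b c d s : K) (R1 R2 E F : 'M[K]_N) :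
    (R1 - q%:M) *m (R1 + (q^-1)%:M) = 0 ->
    R1 *m R2 *m R1 = R2 *m R1 *m R2 ->
    R1 *m F = F *m R1 -> F *m E = E -> R2 *m E = q *: E ->
    E = s *: (F *m (c *: 1%:M + d *: R2) *m F) ->
    c * (a - b / q) + d * a * q = 0 ->
  R1 *m (E *m (a *: 1%:M + b *: R1) *m E) =
    q *: (E *m (a *: 1%:M + b *: R1) *m E).
Proof.
set T := R1 - q%:M; set X := a *: _ + _ => hR YB R1F FE R2E defE coef0.
apply/eqP; rewrite -mul_scalar_mx -subr_eq0 -mulmxBl -/T; apply/eqP.
have TF : T *m F = F *m T by rewrite mulmxBl mulmxBr R1F scalar_mxC.
have TR1 : T *m R1 = (- q^-1) *: T.
  apply/eqP; rewrite scaleNr -addr_eq0 -(mul_mx_scalar _ T) -mulmxDr.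
  by apply/eqP.
have TR2R1E : T *m R2 *m R1 *m E = 0.
  rewrite /T !mulmxBl YB -!mulmxA R2E -!scalemxAr mul_scalar_mx.
  by rewrite subrr.
have FX : F *m X = X *m F.
  by rewrite /X mulmxDl mulmxDr -!scalemxAl -!scalemxAr mul1mx mulmx1 R1F.
have TE : T *m E = s *: (F *m T *m (c *: 1%:M + d *: R2) *m F).
  by rewrite {1}defE -scalemxAr !mulmxA TF.
rewrite !mulmxA TE -!scalemxAl -[_ *m F *m X]mulmxA FX -!mulmxA FE.
suff -> : T *m ((c *: 1%:M + d *: R2) *m (X *m E)) = 0 by rewrite mulmx0 scaler0.
have -> : (c *: 1%:M + d *: R2) *m (X *m E) = (c * a) *: E
    + (c * b) *: (R1 *m E) + ((d * a * q) *: E + (d * b) *: (R2 *m R1 *m E)).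
  rewrite /X !mulmxDl -!scalemxAl !mul1mx mulmxDr -!scalemxAr R2E.
  by rewrite !scalerDr !scalerA !mulmxA.
rewrite !mulmxDr -!scalemxAr !mulmxA TR2R1E scaler0 addr0 TR1 -scalemxAl.
rewrite scalerA -!scalerDl -[RHS](scale0r (T *m E)) -coef0.
by congr (_ *: _); ring.
Qed.

End SymmetrizerStep.

Section Symmetrizer.
Context {K : fieldType} {n : nat}.
Variables (q : K) (R : 'M[K]_(tdim n 2)).
Hypothesis q_neq0 : q != 0.
Hypothesis qint_neq0 : forall k : nat, (0 < k)%N -> qint q k != 0.
Hypothesis R_YB : yang_baxter R.
Hypothesis R_Hecke : hecke q R.
Local Notation S := (qsym q R).

(** For k = 0 the matrix R_1 on a single factor is meaningless, but its
    coefficient vanishes, so that the recursion needs no exception. *)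
Lemma qsymS k : S k.+1 = (qint q k.+1)^-1 *:
  (shift (S k) *m (q ^ (1 - k.+1%:Z) *: 1%:M + qint q k *: Rat k.+1 R 1)
               *m shift (S k)).
Proof.
case: k => [|k]; last by rewrite /= -embed_shift.
rewrite qint0 scale0r addr0 qint1 // invr1 !scale1r /= shift_scalar.
by rewrite !mul1mx.
Qed.

Definition absorbs k (P : 'M[K]_(tdim n k)) := P *m P = P /\
  forall i, (i.+1 < k)%N -> Rat k R i.+1 *m P = q *: P /\ P *m Rat k R i.+1 = q *: P.

(** S begins and ends with the smaller symmetrizer on the factors 2..k+1, which
    absorbs R_i for i > 1 by induction; for i = 1 this is symmetrizer_step. *)
Lemma qsym_absorbs k : absorbs (S k).
Proof.
(* The idempotence of the preceding symmetrizer gives F E = E in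
   symmetrizer_step. *)
suff [] : absorbs (S k) /\ S k.-1 *m S k.-1 = S k.-1 by [].
elim: k => [|k [[idem absR] idem']]; first by do !split; rewrite ?mul1mx.
split=> //.
set E := shift (S k).
have EE : E *m E = E by rewrite -shiftM idem.
have ES : E *m S k.+1 = S k.+1 by rewrite qsymS -scalemxAr !mulmxA EE.
have SE : S k.+1 *m E = S k.+1 by rewrite qsymS -scalemxAl -!mulmxA EE.
have abs1 : (1 < k.+1)%N ->
    Rat k.+1 R 1 *m S k.+1 = q *: S k.+1 /\ S k.+1 *m Rat k.+1 R 1 = q *: S k.+1.
  rewrite qsymS -/E; case: k => // -[|k] in absR idem idem' E EE {ES SE} * => _.
    rewrite /E /= shift_scalar !mul1mx !mulmx1 qint1 // scale1r.
    have := hecke_Rat1 0 R_Hecke; set R1 := Rat 2 R 1.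
    rewrite mulmxBl !mulmxDr !mul_scalar_mx !mul_mx_scalar => hR.
    have R1R1 : R1 *m R1 = q *: R1 - q^-1 *: R1 + 1%:M.
      apply/eqP; rewrite -subr_eq0 -[X in _ == X]hR; apply/eqP.
      rewrite !opprD opprK scale_scalar_mx divff // !addrA.
      by congr (_ - _); rewrite addrAC.
    have eqR1 : q^-1 *: R1 + R1 *m R1 = q *: (q^-1 *: 1%:M + R1).
      rewrite R1R1 scalerDr scalerA divff // scale1r.
      by rewrite addrA [_ + (_ - _)]addrC subrK addrC.
    rewrite (exprz_1sub q_neq0 1) expr1 -!scalemxAl -!scalemxAr mulmxDl mulmxDr.
    by rewrite -!scalemxAl -!scalemxAr mul1mx mulmx1 eqR1 !scalerA mulrC.
  set R1 := Rat k.+3 R 1.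
  (* From three factors on, symmetrizer_step applies. *)
  have hR := hecke_Rat1 k.+1 R_Hecke; have YB := yang_baxter_front k R_YB.
  rewrite -/R1 in hR YB; set R2 := Rat k.+3 R 2 in YB.
  have [R2E ER2] : R2 *m E = q *: E /\ E *m R2 = q *: E.
    have [l r] := absR 0%N isT.
    by rewrite /R2 /E Rat_succ // -!shiftM l r !shiftZ.
  pose F := shift (shift (S k.+1)).
  have R1F : R1 *m F = F *m R1 by apply: Rat1_shift2.
  have defE : E = (qint q k.+2)^-1 *: (F *m (q ^ (1 - k.+2%:Z) *: 1%:M
      + qint q k.+1 *: R2) *m F).
    rewrite /E qsymS shiftZ !shiftM shiftD !shiftZ shift_scalar -/F.
    by rewrite /R2 Rat_succ.
  have FF : F *m F = F.
    by rewrite /F -!shiftM idem'.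
  have FE : F *m E = E by rewrite defE -scalemxAr !mulmxA FF.
  have EF : E *m F = E by rewrite defE -scalemxAl -!mulmxA FF.
  have coef0 : q ^ (1 - k.+2%:Z) * (q ^ (1 - k.+3%:Z) - qint q k.+2 / q)
     + qint q k.+1 * q ^ (1 - k.+3%:Z) * q = 0.
    rewrite (qintS q_neq0 qint_neq0 k.+1) (exprz_1sub q_neq0 k.+1).
    by rewrite (exprz_1sub q_neq0 k.+2) !exprS; field; rewrite q_neq0 expf_neq0.
  set W := E *m _ *m E.
  suff [R1W WR1] : R1 *m W = q *: W /\ W *m R1 = q *: W.
    by rewrite -scalemxAr -scalemxAl R1W WR1 !scalerA mulrC.
  split.
    exact: (symmetrizer_step hR YB R1F FE R2E defE coef0).
  (* All hypotheses of symmetrizer_step are stable under transposition. *)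
  apply: trmx_inj; rewrite linearZ /= trmx_mul /W !trmx_mul raddfD /= !linearZ /= trmx1.
  rewrite (mulmxA E^T).
  apply: (@symmetrizer_step _ _ q _ _ _ _ (qint q k.+2)^-1 _ R2^T _ F^T).
  - move/(congr1 trmx): hR.
    rewrite trmx_mul !raddfD /= raddfN /= !tr_scalar_mx trmx0 => hR.
    rewrite -[RHS]hR !mulmxDl !mulNmx !mulmxN !mul_scalar_mx.
    by rewrite !mul_mx_scalar !scale_scalar_mx (mulrC q) addrACA.
  - by move/(congr1 trmx): YB; rewrite !trmx_mul !mulmxA.
  - by rewrite -!trmx_mul R1F.
  - by rewrite -trmx_mul EF.
  - by rewrite -trmx_mul ER2 linearZ.
  - by rewrite {1}defE linearZ /= !trmx_mul raddfD /= !linearZ /= trmx1 mulmxA.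
  - exact: coef0.
split; last first.
  case=> [|i] lt_ik; first exact: abs1.
  have [l r] := absR i lt_ik; rewrite Rat_succ //; split.
    by rewrite -ES mulmxA /E -shiftM l shiftZ scalemxAl.
  by rewrite -SE -mulmxA /E -shiftM r shiftZ scalemxAr.
case: k => [|k] in idem idem' absR E EE ES SE abs1 *; first by rewrite mul1mx.
rewrite {2}qsymS -scalemxAr !mulmxA SE mulmxDr -!scalemxAr mulmx1.
have [_ ->] := abs1 isT.
rewrite [qint q k.+1 *: _]scalerA -scalerDl -scalemxAl SE scalerA.
rewrite (exprz_1sub q_neq0 k.+1) addrC (mulrC _ q) -qintS // mulVf ?scale1r //.
exact: qint_neq0.
Qed.
End Symmetrizer.

(** * The matrices B and C of a skew-invertible Hecke R-matrix *)

Lemma sum_deltalM (K : fieldType) n (F : 'I_n -> K) a :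
  \sum_c (a == c)%:R * F c = F a.
Proof. by rewrite -[RHS]sum_deltal; apply: eq_bigr => c _; rewrite mulr_natl. Qed.

Section Skew.
Context {K : fieldType} {n : nat}.
Variables (q : K) (R Psi : 'M[K]_(tdim n 2)).
Hypothesis q_neq0 : q != 0.
Hypothesis R_YB : yang_baxter R.
Hypothesis R_Hecke : hecke q R.
Hypothesis R_skew : skew_inverse R Psi.
Local Notation r := (entry R).
Local Notation psi := (entry Psi).
Local Notation B := (Bmx Psi).
Local Notation C := (Cmx Psi).

Lemma insert_at1 k a b (I : multi n k) :
  insert_at (inord 1) a (icons b I) = icons b (icons a I).
Proof.
have -> : inord 1 = lift ord0 ord0 :> 'I_k.+2 by apply: val_inj; rewrite /= inordK.
apply/ffunP => c; rewrite [LHS]ffunE; case: unliftP => [d|] ->; last first.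
  by rewrite iconsS icons0.
case: (unliftP ord0 d) => [e|] ->; rewrite ?iconsS ?icons0.
  have -> : lift (lift ord0 ord0) (lift ord0 e) = lift ord0 (lift ord0 e) :> 'I_k.+2.
    by apply: val_inj.
  by rewrite !iconsS.
have -> : lift (lift ord0 ord0) ord0 = ord0 :> 'I_k.+2 by apply: val_inj.
by rewrite icons0.
Qed.

Lemma insert_at1_index1 a b : insert_at (inord 1) a (index1 b) = index2 b a :> multi n 2.
Proof.
rewrite -(icons_itail (index1 b)) ffunE insert_at1; congr icons.
by apply/ffunP => c; rewrite (ord1 c) icons0 ffunE.
Qed.

Lemma entry_ptrace (X Y : 'M[K]_(tdim n 2)) i j a b :
  entry (ptrace 2 (embed 3 [:: 1%N; 2%N] X *m embed 3 [:: 2%N; 3] Y)) i j a b =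
  \sum_s \sum_t entry X i s a t * entry Y t j s b.
Proof.
rewrite [LHS]opcoef_opmx; apply: eq_bigr => s _; rewrite !insert_at1.
rewrite -/(index2 s j) -/(index2 s b) -opcoef_blk -/(entry _ s j s b).
rewrite -/(Rat 3 X 1) -/(Rat 3 Y 2) Rat_succ // Rat12 blkM_shift entryM.
apply: eq_bigr => t _.
rewrite -[RHS](sum_deltal (fun f => entry X i s a t * entry Y t f s b)).
by apply: eq_bigr => f _; rewrite entry_blk_Rat1 mulrnAl.
Qed.

Lemma entry_flip i j a b :
  entry (flip : 'M[K]_(tdim n 2)) i j a b = (i == b)%:R * (j == a)%:R.
Proof.
rewrite /entry opcoef_opmx /index2 !icons0 (_ : ord_max = lift ord0 ord0) ?iconsS ?ffunE.
  by rewrite -natrM mulnb.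
exact: val_inj.
Qed.

Lemma skewR i j a b :
  \sum_s \sum_t r i s a t * psi t j s b = (i == b)%:R * (j == a)%:R.
Proof. by rewrite -entry_ptrace -entry_flip; case: R_skew => ->. Qed.

Lemma skewL i j a b :
  \sum_s \sum_t psi i s a t * r t j s b = (i == b)%:R * (j == a)%:R.
Proof. by rewrite -entry_ptrace -entry_flip; case: R_skew => _ ->. Qed.

Lemma CmxE i j : C i j = \sum_a psi i a j a.
Proof.
rewrite mxE opcoef_opmx; apply: eq_bigr => a _.
by rewrite -/(Rat 2 Psi 1) Rat12 -/(index1 i) -/(index1 j) !insert_at1_index1.
Qed.

Lemma BmxE i j : B i j = \sum_a psi a i a j.
Proof.
rewrite mxE opcoef_opmx; apply: eq_bigr => a _.
rewrite -/(index1 i) -/(index1 j) !insert_at1_index1 opcoef_embed.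
set pos := @embed_pos _ _ _.
have pos0 : pos ord0 = lift ord0 ord0 by apply: val_inj; rewrite /= inordK.
have pos1 : pos (lift ord0 ord0) = ord0 by apply: val_inj; rewrite /= inordK.
have swap x y : [ffun t => index2 x y (pos t)] = index2 y x.
  apply/ffunP => t; rewrite [LHS]ffunE; case: (unliftP ord0 t) => [u|] ->.
    by rewrite (ord1 u) pos1 iconsS !icons0 ffunE.
  by rewrite pos0 iconsS icons0 ffunE.
rewrite !swap (_ : [forall c, _]) //; apply/forallP => c.
case: (unliftP ord0 c) => [u|] ->; last by rewrite -{1}pos1 codom_f.
by rewrite (ord1 u) -{1}pos0 codom_f.
Qed.

(** Tr_1(B_1 R_{12}) = I, by tracing the second skew-inverse identity over its
    first factor. *)
Lemma Btrace_R j b : \sum_s \sum_t B s t * r t j s b = (j == b)%:R.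
Proof.
transitivity (\sum_i \sum_s \sum_t psi i s i t * r t j s b).
  rewrite [RHS]exchange_big /=; apply: eq_bigr => s _; rewrite [RHS]exchange_big /=.
  by apply: eq_bigr => t _; rewrite BmxE mulr_suml.
under eq_bigr do rewrite skewL.
under eq_bigr do rewrite mulrC.
by rewrite sum_deltalM eq_sym.
Qed.

(** Tr_2(R_{12} C_2) = I, by tracing the first skew-inverse identity over its
    last factor. *)
Lemma Ctrace_R i a : \sum_s \sum_t r i s a t * C t s = (i == a)%:R.
Proof.
transitivity (\sum_j \sum_s \sum_t r i s a t * psi t j s j).
  rewrite [RHS]exchange_big /=; apply: eq_bigr => s _; rewrite [RHS]exchange_big /=.
  by apply: eq_bigr => t _; rewrite CmxE mulr_sumr.
under eq_bigr do rewrite skewR.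
by rewrite sum_deltalM.
Qed.

Lemma entry_scalar c i j a b :
  entry (c%:M : 'M[K]_(tdim n 2)) i j a b = c * (i == a)%:R * (j == b)%:R.
Proof.
by rewrite /entry opcoef_scalar index2_eq -mulrA -natrM mulnb mulr_natr.
Qed.

Lemma hecke_entry i j a b : \sum_x \sum_y r i j x y * r x y a b =
  (i == a)%:R * (j == b)%:R + (q - q^-1) * r i j a b.
Proof.
rewrite -entryM.
have -> : R *m R = 1%:M + (q - q^-1) *: R.
  apply/eqP; rewrite -subr_eq0 -[X in _ == X]R_Hecke; apply/eqP.
  rewrite mulmxBl !mulmxDr !mul_scalar_mx !mul_mx_scalar scale_scalar_mx divff //.
  rewrite scalerBl -[RHS]addrA; congr (_ + _).
  by rewrite !opprD opprK addrC -addrA addrCA.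
by rewrite -[X in X * _]mul1r -entry_scalar /entry /opcoef !mxE.
Qed.

Lemma entry_sum (F : 'I_n -> 'M[K]_(tdim n 2)) j k b c :
  entry (\sum_x F x) j k b c = \sum_x entry (F x) j k b c.
Proof. by rewrite /entry /opcoef summxE. Qed.

Lemma entry_blk_Rat1M i x Y j k e f : entry (blk (Rat 3 R 1) i x *m Y) j k e f =
  \sum_y r i j x y * entry Y y k e f.
Proof.
rewrite entryM; apply: eq_bigr => y _.
rewrite -[RHS](sum_deltal (fun f' => r i j x y * entry Y y f' e f)).
by apply: eq_bigr => f' _; rewrite entry_blk_Rat1 mulrnAl.
Qed.

Lemma entryM_blk_Rat1 i x Y j k e f : entry (Y *m blk (Rat 3 R 1) i x) j k e f =
  \sum_z entry Y j k z f * r i z x e.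
Proof.
rewrite entryM; apply: eq_bigr => y _.
rewrite -[RHS](sum_deltar (fun f' => entry Y j k y f' * r i y x e)).
by apply: eq_bigr => f' _; rewrite entry_blk_Rat1 mulrnAr.
Qed.

Lemma YB_entry i j k a b c :
  \sum_x \sum_z (\sum_y r i j x y * r y k z c) * r x z a b =
  \sum_z \sum_y (\sum_x r j k x y * r i x a z) * r z y b c.
Proof.
have := congr1 (fun X => entry (blk X i a) j k b c) R_YB.
rewrite Rat_succ // Rat12 [in RHS]blkM_shift blk_shiftM blkM entry_sum => eLR.
transitivity (entry (R *m blk (Rat 3 R 1) i a *m R) j k b c); last first.
  rewrite entryM; apply: eq_bigr => z _; apply: eq_bigr => y _.
  by rewrite entryM_blk_Rat1.
rewrite -eLR; apply: eq_bigr => x _.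
rewrite blkM_shift entryM_blk_Rat1; apply: eq_bigr => z _.
by rewrite entry_blk_Rat1M.
Qed.

(** The trace over one factor against C, for a family F of entries F_k^c of
    that factor; all other indices are parameters of F. *)
Definition Ctrace (F : 'I_n -> 'I_n -> K) := \sum_k \sum_c F k c * C c k.

Lemma Ctrace_sum (F : 'I_n -> 'I_n -> 'I_n -> K) :
  Ctrace (fun k c => \sum_x F x k c) = \sum_x Ctrace (F x).
Proof.
rewrite exchange_big; apply: eq_bigr => k _ /=.
by rewrite exchange_big; apply: eq_bigr => c _; rewrite mulr_suml.
Qed.

Lemma CtraceZl m (F : 'I_n -> 'I_n -> K) : Ctrace (fun k c => m * F k c) = m * Ctrace F.
Proof.
rewrite mulr_sumr; apply: eq_bigr => k _; rewrite mulr_sumr.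
by apply: eq_bigr => c _; rewrite mulrA.
Qed.

Lemma eq_Ctrace F G : (forall k c, F k c = G k c) -> Ctrace F = Ctrace G.
Proof.
by move=> eFG; apply: eq_bigr => k _; apply: eq_bigr => c _; rewrite eFG.
Qed.

(** Tr_3(R_{23} R_{12} R_{23} C_3) = I + (q - q^{-1}) R_{12}.  By the Yang-Baxter
    equation the left side is Tr_3(R_{12} R_{23} R_{12} C_3); there C meets only
    R_{23}, whose trace is I, and R_{12}^2 remains. *)
Lemma Ctrace_YB i j a b :
  \sum_x \sum_z r i x a z * Ctrace (fun k c => \sum_y r j k x y * r z y b c) =
  (i == a)%:R * (j == b)%:R + (q - q^-1) * r i j a b.
Proof.
rewrite -hecke_entry.
transitivity (Ctrace (fun k c =>
    \sum_z \sum_y (\sum_x r j k x y * r i x a z) * r z y b c)).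
  rewrite [RHS]Ctrace_sum exchange_big; apply: eq_bigr => z _ /=.
  under eq_bigr do rewrite -CtraceZl.
  rewrite -Ctrace_sum; apply: eq_Ctrace => k c.
  under [RHS]eq_bigr do rewrite mulr_suml.
  rewrite [RHS]exchange_big; apply: eq_bigr => x _; rewrite mulr_sumr.
  by apply: eq_bigr => y _; rewrite mulrA (mulrC (r i x a z)).
rewrite -(eq_Ctrace (fun k c => YB_entry i j k a b c)) Ctrace_sum; apply: eq_bigr => x _.
rewrite Ctrace_sum; apply: eq_bigr => z _.
under eq_Ctrace => k c do rewrite mulrC.
rewrite CtraceZl Ctrace_sum mulrC; congr (_ * _).
under eq_bigr => y _ do rewrite CtraceZl [Ctrace _]Ctrace_R mulrC eq_sym.
exact: sum_deltalM.
Qed.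

(** The functional T contracts Y_{12} with Psi_{01} over the factor 1, multiplies
    by P_{02}, and traces against B over the factor 0.  On I it gives B C, on R it
    gives Tr B, since Psi cancels R, and on the left side of Ctrace_YB it gives I:
    Psi cancels R_{12}, then B and C absorb one R each. *)
Lemma BC_scalar : B *m C = (1 - (q - q^-1) * \tr B)%:M.
Proof.
apply/matrixP => j b.
pose T (Y : 'I_n -> 'I_n -> 'I_n -> 'I_n -> K) :=
  \sum_w \sum_x B w x * \sum_i \sum_a psi x i b a * Y a j i w.
have T1 : T (fun i j a b => (i == a)%:R * (j == b)%:R) = (B *m C) j b.
  rewrite mxE -[RHS](sum_deltalM (fun w => \sum_x B w x * C x b)).
  apply: eq_bigr => w _; rewrite mulr_sumr; apply: eq_bigr => x _.
  rewrite mulrCA CmxE; congr (_ * _); rewrite mulr_sumr; apply: eq_bigr => i _.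
  rewrite [RHS]mulrC -[RHS](sum_deltalM (fun a => psi x i b a * (j == w)%:R)).
  by apply: eq_bigr => a _; rewrite mulrCA eq_sym.
have TR : T r = \tr B * (j == b)%:R.
  rewrite mulr_suml; apply: eq_bigr => w _.
  rewrite -[RHS](sum_deltalM (fun x => B w x * (j == b)%:R)).
  by apply: eq_bigr => x _; rewrite skewL eq_sym mulrCA.
have TZ : T (fun i j a b => \sum_x \sum_z r i x a z *
    Ctrace (fun k c => \sum_y r j k x y * r z y b c)) = (j == b)%:R.
  transitivity (\sum_w \sum_x B w x * Ctrace (fun k c => \sum_y r j k b y * r x y w c)).
    apply: eq_bigr => w _; apply: eq_bigr => x _; congr (_ * _).
    set G := fun x' z => Ctrace (fun k c => \sum_y r j k x' y * r z y w c).
    transitivity (\sum_x' \sum_z (\sum_i \sum_a psi x i b a * r a x' i z) * G x' z).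
      transitivity (\sum_(u : 'I_n * 'I_n) \sum_(v : 'I_n * 'I_n)
          psi x u.1 b u.2 * (r u.2 v.1 u.1 v.2 * G v.1 v.2)).
        rewrite pair_big; apply: eq_bigr => u _ /=.
        by rewrite pair_big mulr_sumr.
      rewrite exchange_big [RHS]pair_big; apply: eq_bigr => v _ /=.
      by rewrite pair_big mulr_suml; apply: eq_bigr => u _; rewrite mulrA.
    rewrite -[RHS](sum_deltalM (fun x' => G x' x)); apply: eq_bigr => x' _.
    rewrite -[G x' x](sum_deltalM (fun z => G x' z)) mulr_sumr.
    by apply: eq_bigr => z _; rewrite skewL -mulrA mulrCA (eq_sym b).
  transitivity (Ctrace (fun k c => \sum_y r j k b y * \sum_w \sum_x B w x * r x y w c)).
    under eq_bigr => w _.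
      under eq_bigr => x _ do rewrite -CtraceZl.
      rewrite -Ctrace_sum; over.
    rewrite -Ctrace_sum; apply: eq_Ctrace => k c; rewrite pair_big /=.
    under [RHS]eq_bigr => y _ do rewrite pair_big mulr_sumr.
    rewrite [RHS]exchange_big; apply: eq_bigr => u _ /=; rewrite mulr_sumr.
    by apply: eq_bigr => y _; rewrite mulrCA.
  rewrite -Ctrace_R; apply: eq_bigr => k _; apply: eq_bigr => c _; congr (_ * _).
  under eq_bigr do rewrite Btrace_R mulrC eq_sym.
  exact: sum_deltalM.
have : T (fun i j a b => (i == a)%:R * (j == b)%:R + (q - q^-1) * r i j a b)
   = (B *m C) j b + (q - q^-1) * (\tr B * (j == b)%:R).
  rewrite -T1 -TR mulr_sumr -big_split; apply: eq_bigr => w _ /=.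
  rewrite mulr_sumr -big_split; apply: eq_bigr => x _ /=.
  rewrite mulrCA -mulrDr; congr (_ * _).
  rewrite mulr_sumr -big_split; apply: eq_bigr => i _ /=.
  rewrite mulr_sumr -big_split; apply: eq_bigr => a _ /=.
  by rewrite mulrDr (mulrCA (q - q^-1)).
have -> : T (fun i j a b => (i == a)%:R * (j == b)%:R + (q - q^-1) * r i j a b)
   = (j == b)%:R.
  rewrite -TZ; apply: eq_bigr => w _; apply: eq_bigr => x _; congr (_ * _).
  apply: eq_bigr => i _; apply: eq_bigr => a _; congr (_ * _).
  by rewrite Ctrace_YB.
move=> /eqP; rewrite -subr_eq => /eqP <-.
by rewrite !mxE -[RHS]mulr_natr [RHS]mulrBl mul1r mulrA.
Qed.
End Skew.

(** * The operators of the generators and of the power sums *)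

Section Repr.
Context {K : fieldType} {n : nat}.
Variables (q : K) (R Psi : 'M[K]_(tdim n 2)).
Hypothesis q_neq0 : q != 0.
Hypothesis qint_neq0 : forall k : nat, (0 < k)%N -> qint q k != 0.
Hypothesis R_YB : yang_baxter R.
Hypothesis R_Hecke : hecke q R.
Hypothesis R_skew : skew_inverse R Psi.
Local Notation B := (Bmx Psi).
Local Notation C := (Cmx Psi).
Local Notation S := (qsym q R).

(** Tr_1(B_1 X) *)
Definition Btrace k (X : 'M[K]_(tdim n k.+1)) : 'M[K]_(tdim n k) :=
  \sum_a \sum_w B w a *: blk X a w.

Lemma BtraceD k (X Y : 'M[K]_(tdim n k.+1)) : Btrace (X + Y) = Btrace X + Btrace Y.
Proof.
rewrite -big_split; apply: eq_bigr => a _; rewrite -big_split.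
by apply: eq_bigr => w _; rewrite blkD scalerDr.
Qed.

Lemma BtraceZ k c (X : 'M[K]_(tdim n k.+1)) : Btrace (c *: X) = c *: Btrace X.
Proof.
rewrite scaler_sumr; apply: eq_bigr => a _; rewrite scaler_sumr.
by apply: eq_bigr => w _; rewrite blkZ !scalerA mulrC.
Qed.

Lemma Btrace_shift k (X Y : 'M[K]_(tdim n k)) Z :
  Btrace (shift X *m Z *m shift Y) = X *m Btrace Z *m Y.
Proof.
rewrite mulmx_sumr mulmx_suml; apply: eq_bigr => a _.
rewrite mulmx_sumr mulmx_suml; apply: eq_bigr => w _.
by rewrite blkM_shift blk_shiftM -scalemxAr -scalemxAl.
Qed.

Lemma Btrace1 k : Btrace (1%:M : 'M[K]_(tdim n k.+1)) = (\tr B)%:M.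
Proof.
rewrite raddf_sum; apply: eq_bigr => a _.
rewrite -[RHS](sum_deltal (fun w => (B w a)%:M)); apply: eq_bigr => w _.
by rewrite blk_scalar -scalerMnr scale_scalar_mx mulr1.
Qed.

Lemma Btrace_Rat1 k : Btrace (Rat k.+2 R 1) = 1%:M.
Proof.
apply: blkP => b d; rewrite blk_scalar -raddfMn -(Btrace_R R_skew) /Btrace exchange_big.
rewrite blk_sum raddf_sum; apply: eq_bigr => w _.
rewrite blk_sum raddf_sum; apply: eq_bigr => a _.
by rewrite blkZ blk_Rat1 scale_scalar_mx.
Qed.

Lemma Btrace_qsym k : Btrace (S k.+1) =
  ((qint q k.+1)^-1 * (q ^ (1 - k.+1%:Z) * \tr B + qint q k)) *: S k.
Proof.
have [idem _] := qsym_absorbs q_neq0 qint_neq0 R_YB R_Hecke k.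
rewrite (qsymS R qint_neq0) BtraceZ Btrace_shift BtraceD !BtraceZ Btrace1 -scalerA.
congr (_ *: _).
case: k idem => [|k] idem.
  by rewrite qint0 scale0r !addr0 /= mul1mx mulmx1 !scale_scalar_mx mulr1.
rewrite Btrace_Rat1 !scale_scalar_mx mulr1 -raddfD mul_mx_scalar.
by rewrite -scalemxAl idem.
Qed.

Lemma blk_pi1_t k i j a b :
  blk (pi1_t Psi k.+1 i j) a b = (B a j *+ (b == i))%:M.
Proof. by rewrite blk_embed1 mxE. Qed.

(** Both sides have the blocks B_x^j delta_y^i Tr_1(B_1 E): the delta of the left
    factor and the B of the right factor close up around E. *)
Lemma pi1_t_contract k (E : 'M[K]_(tdim n k.+1)) i j :
  \sum_a pi1_t Psi k.+1 a j *m E *m pi1_t Psi k.+1 i a =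
  pi1_t Psi k.+1 i j *m shift (Btrace E).
Proof.
apply: blkP => x y; rewrite blkM_shift blk_pi1_t mul_scalar_mx blk_sum.
rewrite scaler_sumr; apply: eq_bigr => a _.
rewrite blkM scaler_sumr; apply: eq_bigr => w _; rewrite blk_pi1_t blkM.
rewrite mul_mx_scalar -[X in _ = _ *: (_ *: X)](sum_deltar (fun u => blk E u w)).
rewrite !scaler_sumr; apply: eq_bigr => u _.
rewrite blk_pi1_t mul_scalar_mx -!scalerMnr !scalerA.
by case: (y == i); case: (u == a); rewrite /= ?mul0r ?mulr0 ?scale0r // mulrC.
Qed.

Lemma hecke_Rat k i : (i.+1 < k)%N ->
  (Rat k R i.+1 - q%:M) *m (Rat k R i.+1 + (q^-1)%:M) = 0.
Proof.
elim: i k => [|i IHi] [|[|k]] // lt_ik; first exact: hecke_Rat1.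
rewrite Rat_succ // -2!(shift_scalar k.+1) -scaleN1r -shiftZ -!shiftD -shiftM.
rewrite scaleN1r IHi //.
by rewrite -(scale0r (0 : 'M_(tdim n k.+1))) shiftZ scale0r.
Qed.

Lemma unit_Rat k i : (i.+1 < k)%N -> Rat k R i.+1 \in unitmx.
Proof.
move=> /hecke_Rat; set T := Rat _ _ _ => hT.
suff /mulmx1_unit[] : T *m (T - (q - q^-1)%:M) = 1%:M by [].
apply/eqP; rewrite -subr_eq0 -[X in _ == X]hT; apply/eqP.
rewrite mulmxBr mulmxBl !mulmxDr !mul_scalar_mx !mul_mx_scalar scale_scalar_mx.
by rewrite divff // scalerBl opprB addrA opprD addrA.
Qed.

Lemma absorbs_chain k (P : 'M[K]_(tdim n k)) (l : seq nat) :
  absorbs q R P -> all (fun t => (0 < t < k)%N) l ->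
  P *m \prod_(t <- l) invmx (Rat k R t) = q^-1 ^+ size l *: P /\
  (\prod_(t <- l) invmx (Rat k R t)) *m P = q^-1 ^+ size l *: P.
Proof.
case=> idem absP.
have unitR t : (0 < t < k)%N -> Rat k R t \in unitmx.
  by case: t => // t; apply: unit_Rat.
have absV t : (0 < t < k)%N -> P *m invmx (Rat k R t) = q^-1 *: P /\
    invmx (Rat k R t) *m P = q^-1 *: P.
  move=> t_ok; have := unitR t t_ok; case: t t_ok => // t t_ok uR.
  have [l1 r1] := absP t t_ok.
  split; apply: (scalerI q_neq0); rewrite scalerA divff // scale1r.
    by rewrite scalemxAl -r1 mulmxK.
  by rewrite scalemxAr -l1 mulKmx.
elim: l => [|t l IHl] /=; first by rewrite big_nil mulmx1 mul1mx scale1r.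
case/andP => /absV[r1 l1] /IHl[r l2]; rewrite big_cons exprS -mulmxE.
split; first by rewrite mulmxA r1 -scalemxAl r scalerA.
by rewrite -mulmxA l2 -scalemxAr l1 scalerA mulrC.
Qed.

(** After absorption each of the k summands of rho_k^t is a multiple of the
    first. *)
Lemma pi_sym_tE k i j : (0 < k)%N -> pi_sym_t q R Psi k i j =
  (q ^ (1 - k%:Z) * qint q k) *: (S k *m pi1_t Psi k i j *m S k).
Proof.
move=> k_gt0; have absS := qsym_absorbs q_neq0 qint_neq0 R_YB R_Hecke k.
rewrite /pi_sym_t /rho_t -sum_qV // [in RHS]big_ltn // expr0 mulr1 scalerDl scale1r.
rewrite mulmxDr mulmxDl; congr (_ + _).
rewrite scaler_suml mulmx_sumr mulmx_suml; apply: eq_big_nat => s /andP[s_gt0 lt_sk].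
rewrite !mulmxA /chain s_gt0.
(* For s = 1 both chains are written in increasing order, but they have a
   single factor. *)
set l1 := index_iota 1 s.+1.
have l1_ok : all (fun t => (0 < t < k)%N) l1.
  by apply/allP => t; rewrite mem_index_iota ltnS => /andP[-> /leq_ltn_trans->].
have sz1 : size l1 = s by rewrite size_iota subn1.
have [_ Rl] := absorbs_chain absS l1_ok.
have rl1_ok : all (fun t => (0 < t < k)%N) (rev l1) by rewrite all_rev.
have [lR _] := absorbs_chain absS rl1_ok; rewrite size_rev sz1 in lR.
have -> : (if (s <= 1)%N then \prod_(t <- index_iota s 2) invmx (Rat k R t)
   else \prod_(t <- rev l1) invmx (Rat k R t)) = \prod_(t <- rev l1) invmx (Rat k R t).
  case: leqP => // s_le1; have s1 : s = 1%N by lia.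
  by rewrite /l1 s1.
by rewrite lR -!mulmxA Rl sz1 -scalemxAl -!scalemxAr scalerA.
Qed.

(** The sum is (B C)_1. *)
Lemma pi1_t_contractC k :
  \sum_a \sum_b C a b *: pi1_t Psi k.+1 b a = (1 - (q - q^-1) * \tr B)%:M.
Proof.
apply: blkP => x y.
rewrite blk_scalar -raddfMn (_ : _ *+ _ = (B *m C) x y); last first.
  by rewrite (BC_scalar q_neq0 R_YB R_Hecke R_skew) mxE.
rewrite mxE raddf_sum blk_sum; apply: eq_bigr => a _.
rewrite -[C a y](sum_deltar (fun b => C a b)) mulr_sumr raddf_sum blk_sum.
apply: eq_bigr => b _; rewrite blkZ blk_pi1_t scale_scalar_mx.
by rewrite mulrnAr mulrnAr mulrC eq_sym.
Qed.

(** The entries of L^(m+1) act as multiples of E pi E, by induction on m: the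
    operators compose in the order opposite to that of the product, which is the
    order needed by pi1_t_contract, and E absorbs the matrix E' left by the
    trace. *)
Lemma tau_s_elt k (E : 'M[K]_(tdim n k.+1)) (E' : 'M[K]_(tdim n k)) c kappa m tau :
  represents E (fun i j => c *: (E *m pi1_t Psi k.+1 i j *m E)) tau ->
  E *m E = E -> shift E' *m E = E -> Btrace E = kappa *: E' ->
  tau (s_elt R Psi m.+1) =
   (c * (c * kappa) ^+ m * (1 - (q - q^-1) * \tr B)) *: E.
Proof.
case=> tau_lin tau1 tauM tauL EE E'E trE.
pose tauL_ := GRing.isLinear.Build K (REA R) 'M[K]_(tdim n k.+1) *:%R tau tau_lin.
pose tl : {linear REA R -> 'M[K]_(tdim n k.+1)} := HB.pack tau tauL_.
have tau_sum (F : 'I_n -> REA R) : tau (\sum_a F a) = \sum_a tau (F a).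
  exact: (raddf_sum tl).
have tauZ x y : tau (x *: y) = x *: tau y by exact: (linearZ_LR tl).
have tauLm i j : tau ((Lmx R ^+ m.+1) i j) =
    (c * (c * kappa) ^+ m) *: (E *m pi1_t Psi k.+1 i j *m E).
  elim: m i j => [|m IHm] i j; first by rewrite expr1 tauL mulr1.
  rewrite exprSr mxE tau_sum.
  transitivity ((c * (c * (c * kappa) ^+ m)) *: (E *m
    (\sum_a pi1_t Psi k.+1 a j *m E *m pi1_t Psi k.+1 i a) *m E)).
    rewrite mulmx_sumr mulmx_suml scaler_sumr; apply: eq_bigr => a _.
    rewrite tauM IHm tauL -scalemxAl -scalemxAr scalerA.
    by congr (_ *: _); rewrite !mulmxA -(mulmxA _ E E) EE.
  rewrite pi1_t_contract trE shiftZ -!scalemxAr -!scalemxAl scalerA -!mulmxA E'E.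
  by congr (_ *: _); rewrite exprS; ring.
rewrite /s_elt /Tr_q /mxtrace tau_sum.
transitivity (\sum_a (c * (c * kappa) ^+ m) *:
   (E *m (\sum_b C a b *: pi1_t Psi k.+1 b a) *m E)).
  apply: eq_bigr => a _; rewrite mxE tau_sum mulmx_sumr mulmx_suml scaler_sumr.
  apply: eq_bigr => b _; rewrite mxE mulr_algl tauZ tauLm.
  by rewrite -scalemxAr -scalemxAl !scalerA mulrC.
rewrite -scaler_sumr -mulmx_suml -mulmx_sumr pi1_t_contractC.
by rewrite mul_mx_scalar -scalemxAl EE scalerA.
Qed.

Lemma tau_s_elt_sym k m tau :
  represents (S k.+1) (pi_sym_t q R Psi k.+1) tau ->
  tau (s_elt R Psi m.+1) =
   (q ^ (1 - k.+1%:Z) * qint q k.+1 *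
     (q ^ (1 - k.+1%:Z) * (q ^ (1 - k.+1%:Z) * \tr B + qint q k)) ^+ m *
     (1 - (q - q^-1) * \tr B)) *: S k.+1.
Proof.
case=> lin_tau tau1 tauM tauL.
have [idem _] := qsym_absorbs q_neq0 qint_neq0 R_YB R_Hecke k.+1.
have [idem' _] := qsym_absorbs q_neq0 qint_neq0 R_YB R_Hecke k.
have SS : shift (S k) *m S k.+1 = S k.+1.
  by rewrite (qsymS R qint_neq0) -scalemxAr !mulmxA -shiftM idem'.
have rep : represents (S k.+1) (fun i j => (q ^ (1 - k.+1%:Z) * qint q k.+1) *:
     (S k.+1 *m pi1_t Psi k.+1 i j *m S k.+1)) tau.
  by split=> // i j; rewrite tauL pi_sym_tE.
rewrite (tau_s_elt _ rep idem SS (Btrace_qsym k)); congr (_ *: _).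
congr (_ * _ ^+ _ * _).
by rewrite -mulrA mulVKf ?qint_neq0.
Qed.
End Repr.

(** * The substitution q -> - q^{-1} *)

Section Dual.
Context {K : fieldType} {n : nat}.
Variables (q : K) (R : 'M[K]_(tdim n 2)).
Hypothesis q_neq0 : q != 0.
Local Notation q' := (- q^-1).

Lemma qint_generic : (forall k : nat, (0 < k)%N -> q ^+ k != 1) ->
  forall k : nat, (0 < k)%N -> qint q k != 0.
Proof.
move=> q_gen.
have sub_neq0 k : (0 < k)%N -> q ^+ k - (q ^+ k)^-1 != 0.
  move=> k_gt0; rewrite subr_eq0; apply: contraNneq (q_gen (k + k)%N _) => [e|].
    by rewrite exprD {2}e mulfV ?expf_neq0.
  by rewrite addn_gt0 k_gt0.
move=> k k_gt0; rewrite qint_nat mulf_neq0 ?invr_neq0 ?sub_neq0 //.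
by have := sub_neq0 1%N isT; rewrite expr1.
Qed.

Lemma dual_neq0 : q' != 0.
Proof. by rewrite oppr_eq0 invr_eq0. Qed.

Lemma dual_expr (k : nat) : q' ^+ k = (-1) ^+ k / q ^+ k.
Proof. by rewrite [LHS]exprNn exprVn. Qed.

Lemma dual_exprV (k : nat) : (q' ^+ k)^-1 = (-1) ^+ k * q ^+ k.
Proof. by rewrite dual_expr invfM invrK invr_sign. Qed.

Lemma dual_lambda : q' - q'^-1 = q - q^-1.
Proof. by rewrite invrN invrK opprK addrC. Qed.

Lemma dual_qint (k : nat) : qint q' k = - (-1) ^+ k * qint q k.
Proof.
rewrite !qint_nat dual_lambda dual_exprV dual_expr -mulrBr.
by rewrite [RHS]mulrA mulNr -mulrN opprB.
Qed.

Lemma dual_qint_neq0 : (forall k : nat, (0 < k)%N -> qint q k != 0) ->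
  forall k : nat, (0 < k)%N -> qint q' k != 0.
Proof.
by move=> q_gen k k_gt0; rewrite dual_qint mulf_neq0 ?q_gen // oppr_eq0 signr_eq0.
Qed.

Lemma hecke_dual : hecke q R -> hecke q' R.
Proof.
rewrite /hecke => <-; rewrite invrN invrK !raddfN /= opprK.
rewrite !mulmxDl !mulmxDr !mulNmx !mulmxN !mul_scalar_mx !mul_mx_scalar.
by rewrite !scale_scalar_mx (mulrC q) addrACA.
Qed.

Lemma exprz_sub1 (k : nat) : q ^ (k.+1%:Z - 1) = q ^+ k.
Proof. by rewrite (_ : k.+1%:Z - 1 = k%:Z) //; lia. Qed.

Lemma qsymSS (a : K) k : qsym a R k.+2 = (qint a k.+2)^-1 *:
  (shift (qsym a R k.+1) *m (a ^ (1 - k.+2%:Z) *: 1%:M + qint a k.+1 *: Rat k.+2 R 1)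
    *m shift (qsym a R k.+1)).
Proof. by rewrite -embed_shift. Qed.

Lemma qasymSS (a : K) k : qasym a R k.+2 = (qint a k.+2)^-1 *:
  (shift (qasym a R k.+1) *m (a ^ (k.+2%:Z - 1) *: 1%:M - qint a k.+1 *: Rat k.+2 R 1)
    *m shift (qasym a R k.+1)).
Proof. by rewrite -embed_shift. Qed.

(** The k-th q-number changes by (-1)^(k-1) under the substitution, so the
    sign (-1)^(k-1) comes out of the middle factor of the recursion and
    cancels against its normalisation. *)
Lemma qasym_dual k : qasym q R k = qsym q' R k.
Proof.
elim: k => [|[|k] IHk]; [by [] | by [] | rewrite qasymSS qsymSS IHk].
rewrite exprz_sub1 (exprz_1sub dual_neq0 k.+1) dual_exprV !dual_qint.
set S := shift _; set R1 := Rat _ _ _.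
have -> : ((-1) ^+ k.+1 * q ^+ k.+1) *: 1%:M + (- (-1) ^+ k.+1 * qint q k.+1) *: R1 =
  (-1) ^+ k.+1 *: (q ^+ k.+1 *: 1%:M - qint q k.+1 *: R1).
  by rewrite scalerBr !scalerA mulNr scaleNr.
rewrite -scalemxAr -scalemxAl scalerA; congr (_ *: _).
rewrite (exprS (-1) k.+1) mulN1r opprK [in RHS]invfM invr_sign mulrAC.
by rewrite -expr2 sqrr_sign mul1r.
Qed.
End Dual.

(** * Tr B and the characters of the power sums *)

Theorem corollary1 (RR : realType) (n : nat) (q : RR[i])
    (R Psi : 'M[RR[i]]_(tdim n 2)) (p : nat)
    (n_ge1 : (1 <= n)%N) (q_neq0 : q != 0)
    (q_generic : forall k : nat, (1 <= k)%N -> q ^+ k != 1)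
    (R_YB : yang_baxter R) (R_Hecke : hecke q R)
    (R_skew : skew_inverse R Psi) (R_rank : symmetry_rank q R p) :
  [/\ forall (k : nat) (i j : 'I_n), (1 <= k)%N ->
        pi_sym_t q R Psi k i j =
        (q ^ (1 - k%:Z) * qint q k) *:
          (qsym q R k *m pi1_t Psi k i j *m qsym q R k),
      forall (k : nat) (i j : 'I_n), (1 <= k <= p)%N ->
        pi_asym_t q R Psi k i j =
        (q ^ (k%:Z - 1) * qint q k) *:
          (qasym q R k *m pi1_t Psi k i j *m qasym q R k),
      forall (k m : nat) (tau : REA R -> 'M[RR[i]]_(tdim n k)),
        (1 <= k)%N -> (1 <= m)%N ->
        represents (qsym q R k) (pi_sym_t q R Psi k) tau ->
        forall v : 'rV[RR[i]]_(tdim n k), (v <= qsym q R k)%MS ->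
          v *m tau (s_elt R Psi m) =
          (q ^ (- (m%:Z * (p%:Z + k%:Z - 1)) - p%:Z) * qint q k
             * qint q (p%:Z + k%:Z - 1) ^+ m.-1) *: v &
      forall (k m : nat) (tau : REA R -> 'M[RR[i]]_(tdim n k)),
        (1 <= k <= p)%N -> (1 <= m)%N ->
        represents (qasym q R k) (pi_asym_t q R Psi k) tau ->
        forall v : 'rV[RR[i]]_(tdim n k), (v <= qasym q R k)%MS ->
          v *m tau (s_elt R Psi m) =
          (q ^ (- (m%:Z * (p%:Z - k%:Z + 1)) - p%:Z) * qint q k
             * qint q (p%:Z - k%:Z + 1) ^+ m.-1) *: v].
Proof.
have qint_n0 := qint_generic q_neq0 q_generic.
have q'_neq0 := dual_neq0 q_neq0; have qint'_n0 := dual_qint_neq0 qint_n0.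
have R_Hecke' := hecke_dual R_Hecke.
have pi_asymE k i j : pi_asym_t q R Psi k i j = pi_sym_t (- q^-1) R Psi k i j.
  by rewrite /pi_asym_t (qasym_dual R q_neq0).
pose x := q ^+ p.
have x_n0 : x != 0 by rewrite expf_neq0.
have q2 : q * q - 1 != 0 by rewrite -expr2 q2_neq1.
(* Trace A^(p+1) = 0 over its first factor; A^(p) is not zero. *)
have trB : \tr (Bmx Psi) = x^-1 * qint q p.
  have [p_gt0 A0 A1] := R_rank.
  have := Btrace_qsym q'_neq0 qint'_n0 R_YB R_Hecke' R_skew p.
  rewrite -!(qasym_dual R q_neq0) A0 (_ : Btrace _ _ = 0); last first.
    by rewrite -[X in Btrace _ X](scale0r 0) BtraceZ scale0r.
  move=> /esym/eqP; rewrite scaler_eq0 => /orP[|/eqP A_eq0]; last first.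
    by move: A1; rewrite A_eq0 mxrank0.
  rewrite mulf_eq0 invr_eq0 (negPf (qint'_n0 p.+1 isT)) /=.
  rewrite (exprz_1sub q'_neq0 p) dual_exprV dual_qint -mulrA mulNr -mulrBr.
  rewrite mulf_eq0 signr_eq0 subr_eq0 => /eqP <-.
  by rewrite mulKf.
have BC : 1 - (q - q^-1) * \tr (Bmx Psi) = (x * x)^-1.
  rewrite trB qint_nat -/x; field.
  by rewrite x_n0 q_neq0 q2.
have act k (E T : 'M[RR[i]]_(tdim n k)) (a b : RR[i]) (v : 'rV_(tdim n k)) :
  E *m E = E -> T = a *: E -> a = b -> (v <= E)%MS -> v *m T = b *: v.
  move=> EE -> -> /submxP[w ->]; by rewrite -scalemxAr -mulmxA EE.
split.
- by move=> k i j k_gt0; apply: pi_sym_tE.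
- move=> k i j /andP[k_gt0 _]; rewrite pi_asymE (qasym_dual R q_neq0) pi_sym_tE //.
  congr (_ *: _); case: k k_gt0 => // k _.
  rewrite dual_qint (exprz_1sub q'_neq0 k) dual_exprV (exprz_sub1 q_neq0 k).
  rewrite exprS mulN1r opprK.
  by rewrite mulrACA -expr2 sqrr_sign mul1r.
- move=> [//|k] [//|m] tau _ _ rep v v_in.
  have [idem _] := qsym_absorbs q_neq0 qint_n0 R_YB R_Hecke k.+1.
  apply: act idem (tau_s_elt_sym q_neq0 qint_n0 R_YB R_Hecke R_skew m rep) _ v_in.
  rewrite BC trB (exprz_1sub q_neq0 k).
  have -> : p%:Z + k.+1%:Z - 1 = (p + k)%N by lia.
  have -> : - (m.+1%:Z * (p + k)%N) - p%:Z = - (m.+1 * (p + k) + p)%N%:Z by lia.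
  rewrite -exprnN -[m.+1.-1]/m; pose y := q ^+ k.
  have y_n0 : y != 0 by rewrite expf_neq0.
  have -> : (q ^+ k)^-1 * (x^-1 * qint q p) + qint q k = x^-1 * qint q (p + k)%N.
    rewrite !qint_nat exprD -/x -/y; field.
    by rewrite x_n0 y_n0 q_neq0 q2.
  have -> : q ^+ (m.+1 * (p + k) + p) = y * x * (y * x) ^+ m * x.
    by rewrite exprD mulnC exprM exprD exprS -/x -/y (mulrC x y).
  rewrite -/y; move: (qint q k.+1) (qint q (p + k)%N) => Q1 Q.
  rewrite [y^-1 * (x^-1 * Q)]mulrA -invfM exprMn exprVn; set w := (y * x) ^+ m.
  have w_n0 : w != 0 by rewrite expf_neq0 ?mulf_neq0.
  by field; rewrite x_n0 y_n0 w_n0.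
- move=> [//|k] [//|m] tau /andP[_ le_kp] _; rewrite (qasym_dual R q_neq0) => rep v v_in.
  have [idem _] := qsym_absorbs q'_neq0 qint'_n0 R_YB R_Hecke' k.+1.
  have rep' : represents (qsym (- q^-1) R k.+1) (pi_sym_t (- q^-1) R Psi k.+1) tau.
    case: rep => lin one mul tauL; split; [exact: lin | exact: one | exact: mul |].
    by move=> i j; rewrite tauL pi_asymE.
  apply: act idem (tau_s_elt_sym q'_neq0 qint'_n0 R_YB R_Hecke' R_skew m rep') _ v_in.
  rewrite dual_lambda BC trB (exprz_1sub q'_neq0 k).
  have -> : p%:Z - k.+1%:Z + 1 = (p - k)%N by lia.
  have -> : - (m.+1%:Z * (p - k)%N) - p%:Z = - (m.+1 * (p - k) + p)%N%:Z by lia.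
  rewrite -exprnN -[m.+1.-1]/m dual_exprV !dual_qint.
  pose y := q ^+ k; pose z := q ^+ (p - k).
  have [y_n0 z_n0] : y != 0 /\ z != 0 by rewrite !expf_neq0.
  have xE : x = z * y by rewrite -exprD subnK // ltnW.
  have -> : (-1) ^+ k * q ^+ k * ((-1) ^+ k * q ^+ k * (x^-1 * qint q p)
      + - (-1) ^+ k * qint q k) = z^-1 * qint q (p - k)%N.
    transitivity ((-1) ^+ k * (-1) ^+ k * (y * (y * (x^-1 * qint q p) - qint q k))).
      by rewrite -/y; ring.
    rewrite -expr2 sqrr_sign mul1r !qint_nat -/x -/y -/z xE; field.
    by rewrite y_n0 z_n0 q_neq0 q2.
  have -> : q ^+ (m.+1 * (p - k) + p) = z * z ^+ m * x.
    by rewrite exprD mulnC exprM exprS.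
  rewrite exprS mulN1r opprK mulrACA -expr2 sqrr_sign mul1r -/y exprMn exprVn xE.
  set w := z ^+ m; have w_n0 : w != 0 by rewrite expf_neq0.
  by field; rewrite y_n0 z_n0 w_n0.
Qed.
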